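(* Let $(b_n)_{n\ge1}$ be a summable sequence of positive numbers and $(k_n)_{n\ge1}$ a sequence of distinct real points satisfying the spacing condition (S) described in the context, and let $P_{\mathbb H}(z)=z+\sum_{n=1}^{+\infty}\frac{4b_n}{z-k_n}$. (1) If there exists a complex root $\beta\in\mathbb H$ of $P_{\mathbb H}$, then $\beta,\bar\beta$ are the unique roots in $\mathbb C\setminus\mathbb R$, they are simple, and each bounded interval $I_j$ has exactly one root of $P_{\mathbb H}$, which is the standard root $\lambda_j$. If there exist unbounded intervals, they contain no real roots of $P_{\mathbb H}$. (2) If some interval of $P_{\mathbb H}$, say $I$, contains distinct simple real roots of $P_{\mathbb H}$, then $I$ has exactly three distinct roots, two of which are standard, if it is bounded, or exactly two distinct roots, one of which is standard, if it is unbounded. Each other interval has exactly one root, which is standard, if it is bounded, and no root if it is unbounded; and $P_{\mathbb H}$ has no complex (non-real) roots. (3) If there exists a multiple real root $\rho_0$ of $P_{\mathbb H}$, lying either in a bounded or in an unbounded interval (assuming that such an unbounded interval exists), then $P_{\mathbb H}$ has only real roots and we have the following cases: (a) either $\rho_0$ is a double root and each bounded interval $I_j$ has exactly one simple root, the standard root $\lambda_j$, while if there exist unbounded intervals, they contain no roots (except possibly $\rho_0$); (b) or $\rho_0$ is a triple root, which can only lie in some bounded interval $I_m$ and coincides with the root $\lambda_m$ of that interval (i.e. $\rho_0$ takes the place of the standard root, $\lambda_m=\rho_0$). Each other bounded interval $I_j$ has exactly one simple root, the standard root $\lambda_j$, while if there exist unbounded intervals, they contain no roots.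
   Context: $\mathbb H=\{z\in\mathbb C:\operatorname{Im}z>0\}$. Condition (S) on the distinct real points $(k_n)_{n\ge1}$: for each $j$ for which there is $j'\ne j$ with $k_j<k_{j'}$ and $(k_j,k_{j'})$ containing no $k_n$, put $I_j=(k_j,k_{j'})$ (a bounded interval of $P_{\mathbb H}$). Put $I_-=(-\infty,\min_n k_n)$ if the minimum exists and $I_-=\emptyset$ otherwise, $I_+=(\max_n k_n,+\infty)$ if the maximum exists and $I_+=\emptyset$ otherwise (the unbounded intervals of $P_{\mathbb H}$). It is required that $\mathbb R=\overline{I_-}\cup\bigcup_j\overline{I_j}\cup\overline{I_+}$ and that $d:=\inf_j|I_j|>0$. ''Intervals of $P_{\mathbb H}$'' are the intervals $I_j$, $I_-$, $I_+$. $P_{\mathbb H}$ is defined on $\mathbb C\setminus\{k_n:n\ge1\}$. A root $\rho\in\mathbb R$ of $P_{\mathbb H}$ is called standard if $P_{\mathbb H}'(\rho)<0$. In a bounded interval $I_j$, $\lambda_j$ denotes its standard root. *)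

(* Defs.v *)
From mathcomp Require Import all_boot all_order all_algebra.
From mathcomp Require Import all_classical all_reals all_analysis.
From mathcomp.real_closed Require Export complex.
Set Implicit Arguments.
Unset Strict Implicit.
Unset Printing Implicit Defensive.
Import Order.TTheory GRing.Theory Num.Theory.
Import numFieldNormedType.Exports.
Local Open Scope classical_set_scope.
Local Open Scope ring_scope.
Local Open Scope complex_scope.

(* R[i]^o is R[i] with its topology as a normed field.  Sequences are indexed
   from 0.  The value at a pole k n is irrelevant: see [PH_root]. *)
Definition PH (R : realType) (b k : nat -> R) (z : R[i]) : R[i]^o :=
  z + limn (series (fun n => (4 * b n)%:C / (z - (k n)%:C) : R[i]^o)).

(* Iterated complex derivative: the base field of [derive1n] is R[i]. *)
Definition dPH (R : realType) (b k : nat -> R) (m : nat) : R[i] -> R[i]^o :=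
  derive1n m (PH b k).

Section Intervals.
Variables (R : realType) (k : nat -> R).

Definition consecutive (j j' : nat) : Prop :=
  k j < k j' /\ forall n, ~ (k j < k n < k j').

Definition bounded_interval (I : set R) : Prop :=
  exists j j', consecutive j j' /\ I = [set x | k j < x < k j'].

(* Empty when k has no minimum, resp. no maximum. *)
Definition I_minus : set R := [set x | exists2 m, forall n, k m <= k n & x < k m].
Definition I_plus : set R := [set x | exists2 m, forall n, k n <= k m & k m < x].

Definition unbounded_interval (I : set R) : Prop :=
  I !=set0 /\ (I = I_minus \/ I = I_plus).

Definition PH_interval (I : set R) : Prop :=
  bounded_interval I \/ unbounded_interval I.

Definition spacing_condition : Prop :=
  [set: R] = closure I_minus `|` (\bigcup_(I in bounded_interval) closure I)
             `|` closure I_plus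
  /\ 0 < inf [set l | exists j j', consecutive j j' /\ l = k j' - k j].

End Intervals.

Section Roots.
Variables (R : realType) (b k : nat -> R).

Definition PH_root (z : R[i]) : Prop :=
  (forall n, z <> (k n)%:C) /\ PH b k z = 0.

Definition PH_root_mult (m : nat) (z : R[i]) : Prop :=
  [/\ (forall n, z <> (k n)%:C),
      (forall i, (i < m)%N -> dPH b k i z = 0)
    & dPH b k m z <> 0].

Definition simple_root (z : R[i]) : Prop := PH_root_mult 1 z.
Definition double_root (z : R[i]) : Prop := PH_root_mult 2 z.
Definition triple_root (z : R[i]) : Prop := PH_root_mult 3 z.

Definition multiple_root (z : R[i]) : Prop := PH_root z /\ dPH b k 1 z = 0.

(* In R[i], w < 0 means that w is real and negative. *)
Definition standard_root (x : R) : Prop :=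
  PH_root x%:C /\ (dPH b k 1 x%:C : R[i]) < 0.

Definition roots_in (I : set R) : set R := [set x | I x /\ PH_root x%:C].

Definition standard_roots_in (I : set R) : set R :=
  [set x | I x /\ standard_root x].

End Roots.

(* Main.v *)
Require Import Defs.
From mathcomp Require Import all_boot all_order all_algebra.
From mathcomp Require Import all_classical all_reals all_analysis.
From mathcomp Require Import ring lra.
Import Order.TTheory GRing.Theory Num.Theory.
Import numFieldNormedType.Exports.
Local Open Scope classical_set_scope.
Local Open Scope card_scope.
Local Open Scope ring_scope.
Local Open Scope complex_scope.

(* Write [S z] for the sum of [4 b_n / |z - k_n|^2].  Subtracting the equations
   of two distinct roots [z], [w] gives [sum 4 b_n / ((z - k_n) (w - k_n)) = 1],
   and expanding [sum 4 b_n |1 / (z - k_n) - conj (1 / (w - k_n))|^2 > 0] yields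
   [S z + S w > 2] unless [w = conj z], while [S z = 1] for a non-real root.
   Since [PH' = 1 - S] on the real line, all roots but one, up to conjugation,
   are standard real roots.

   Inside one interval the differences [x - k_n] keep their sign, so the fourth
   order divided differences of [PH] are negative there, and those of third
   order have a constant sign on an unbounded interval.  Newton's formula then
   shows that once [PH] has two roots (with multiplicity) in a bounded interval
   it equals [(w - x) (w - y) (w - z)] times a negative function, and that once
   it has one root in an unbounded interval it equals [(w - x) (w - y)] times a
   function of constant sign.  This determines the number of roots in the
   interval and the sign of [PH'] at each of them. *)

(** * Weighted sums over bounded sequences *)

Section WeightedSum.
Set Implicit Arguments.
Unset Strict Implicit.
Variables (R : realType) (a : nat -> R).
Hypotheses (a_gt0 : forall n, 0 < a n) (a_sum : cvgn (series a)).

(** For separated poles the numbers [1 / (x - k n)] stay bounded at any [x] off the poles.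
    Boundedness of [c] thus suffices for every series below to converge, by comparison with the
    summable weights. *)
Definition bounded_seq (c : nat -> R) := exists M, forall n, `|c n| <= M.

Definition wsum (c : nat -> R) : R := limn (series (fun n => a n * c n)).

Lemma bounded_seqD c d : bounded_seq c -> bounded_seq d ->
  bounded_seq (fun n => c n + d n).
Proof.
move=> [M cM] [N dN]; exists (M + N) => n.
by rewrite (le_trans (ler_normD _ _))// lerD.
Qed.

Lemma bounded_seqM c d : bounded_seq c -> bounded_seq d ->
  bounded_seq (fun n => c n * d n).
Proof.
move=> [M cM] [N dN]; exists (M * N) => n.
by rewrite normrM ler_pM.
Qed.

Lemma bounded_seq_cst x : bounded_seq (fun=> x).
Proof. by exists `|x| => n. Qed.

Lemma bounded_seqN c : bounded_seq c -> bounded_seq (fun n => - c n).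
Proof. by move=> [M cM]; exists M => n; rewrite normrN. Qed.

Lemma wsum_cvg c : bounded_seq c -> cvgn (series (fun n => a n * c n)).
Proof.
move=> [M cM]; apply: normed_cvg.
apply: (@series_le_cvg _ _ (fun n => M * a n)) => [n|n|n|].
- exact: normr_ge0.
- by rewrite mulr_ge0 ?(ltW (a_gt0 n))// (le_trans _ (cM n)).
- by rewrite /= normrM (gtr0_norm (a_gt0 n)) mulrC ler_pM2r.
- exact: is_cvg_seriesZ a_sum.
Qed.

Lemma wsumD c d : bounded_seq c -> bounded_seq d ->
  wsum (fun n => c n + d n) = wsum c + wsum d.
Proof.
move=> bc bd; rewrite /wsum -lim_seriesD; [|exact: wsum_cvg..].
by congr (limn (series _)); apply/funext => n; rewrite mulrDr.
Qed.

Lemma wsumZ x c : bounded_seq c -> wsum (fun n => x * c n) = x * wsum c.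
Proof.
move=> bc; rewrite /wsum -[RHS]lim_seriesZ; last exact: wsum_cvg.
by congr (limn (series _)); apply/funext => n; rewrite mulrCA.
Qed.

Lemma wsumN c : bounded_seq c -> wsum (fun n => - c n) = - wsum c.
Proof.
move=> bc; rewrite -mulN1r -wsumZ//; congr wsum.
by apply/funext => n; rewrite mulN1r.
Qed.

(** Partial sums of nonnegative terms increase to the limit, and the one of index [j.+1] already
    contains term [j]. Besides positivity, this gives the blow-up of [pfun] next to a pole. *)
Lemma wsum_ge_term c j : bounded_seq c -> (forall n, 0 <= c n) ->
  a j * c j <= wsum c.
Proof.
move=> bc c0; have nd : nondecreasing_seq (series (fun n => a n * c n)).
  by apply: nondecreasing_series => n _ _; rewrite mulr_ge0// ltW.
apply: le_trans (nondecreasing_cvgn_le nd (wsum_cvg bc) j.+1).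
rewrite /series/= big_nat_recr//= lerDr sumr_ge0// => i _.
by rewrite mulr_ge0// ltW.
Qed.

Lemma wsum_ge0 c : bounded_seq c -> (forall n, 0 <= c n) -> 0 <= wsum c.
Proof.
move=> bc c0; apply: le_trans (wsum_ge_term 0 bc c0).
by rewrite mulr_ge0// ltW.
Qed.

Lemma wsum_gt0 c : bounded_seq c -> (forall n, 0 < c n) -> 0 < wsum c.
Proof.
move=> bc c0; apply: lt_le_trans (wsum_ge_term 0 bc _).
  by rewrite mulr_gt0.
by move=> n; rewrite ltW.
Qed.

Lemma ler_wsum c d : bounded_seq c -> bounded_seq d ->
  (forall n, c n <= d n) -> wsum c <= wsum d.
Proof.
move=> bc bd cd; apply: lim_series_le => [||n]; [exact: wsum_cvg..|].
by rewrite ler_pM2l.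
Qed.

Lemma ler_norm_wsum c M : (forall n, `|c n| <= M) ->
  `|wsum c| <= M * wsum (fun=> 1).
Proof.
move=> cM; have bc : bounded_seq c by exists M.
rewrite -wsumZ; last exact: bounded_seq_cst.
have b1 : bounded_seq (fun=> M * 1) by exact: bounded_seq_cst.
have bN := bounded_seqN b1.
rewrite ler_norml -wsumN//; apply/andP; split; apply: ler_wsum => // n.
- by rewrite mulr1; case/ler_normlP : (cM n); rewrite lerNl.
- by rewrite mulr1; case/ler_normlP : (cM n).
Qed.

End WeightedSum.

(** * Complex weighted sums and their limits *)

Section ComplexWeightedSum.
Set Implicit Arguments.
Unset Strict Implicit.
Variables (R : realType) (a : nat -> R).
Hypotheses (a_gt0 : forall n, 0 < a n) (a_sum : cvgn (series a)).
Import Normc.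

Lemma normc_Re_le (z : R[i]) : `|complex.Re z| <= normc z.
Proof. by case: z => x y /=; rewrite -sqrtr_sqr ler_wsqrtr// lerDl sqr_ge0. Qed.

Lemma normc_Im_le (z : R[i]) : `|complex.Im z| <= normc z.
Proof. by case: z => x y /=; rewrite -sqrtr_sqr ler_wsqrtr// lerDr sqr_ge0. Qed.

Lemma normc_le_ReIm (z : R[i]) :
  normc z <= `|complex.Re z| + `|complex.Im z|.
Proof.
case: z => x y /=; rewrite -(ler_sqr (x := Num.sqrt _)) ?nnegrE ?sqrtr_ge0 ?addr_ge0//.
rewrite sqr_sqrtr ?addr_ge0 ?sqr_ge0// sqrrD !real_normK ?num_real//.
by rewrite lerD2r lerDl mulrn_wge0 ?mulr_ge0.
Qed.

Lemma normcE_complex (z : R[i]) : `|z| = (normc z)%:C.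
Proof. by case: z. Qed.

Lemma normc_ge0 (z : R[i]) : 0 <= normc z.
Proof. by case: z => x y /=; rewrite sqrtr_ge0. Qed.

Lemma normc_real (x : R) : normc x%:C = `|x|.
Proof. by rewrite /= expr0n addr0 sqrtr_sqr. Qed.

Lemma ler_normcD (x y : R[i]) : normc (x + y) <= normc x + normc y.
Proof. by rewrite -lecR rmorphD/= -!normcE_complex ler_normD. Qed.

Lemma normcX (x : R[i]) m : normc (x ^+ m) = normc x ^+ m.
Proof.
by elim: m => [|m IH]; rewrite ?expr0 ?normc1// !exprS normcM IH.
Qed.

Definition bounded_cseq (c : nat -> R[i]) := exists M, forall n, normc (c n) <= M.

(** Taken componentwise so that the real lemmas apply to each part; [limn_cwsum] identifies it with
    the limit in [R[i]^o]. *)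
Definition cwsum (c : nat -> R[i]) : R[i] :=
  Complex (wsum a (fun n => complex.Re (c n))) (wsum a (fun n => complex.Im (c n))).

Lemma bounded_Re c : bounded_cseq c -> bounded_seq (fun n => complex.Re (c n)).
Proof. by move=> [M cM]; exists M => n; apply: le_trans (normc_Re_le _) (cM n). Qed.

Lemma bounded_Im c : bounded_cseq c -> bounded_seq (fun n => complex.Im (c n)).
Proof. by move=> [M cM]; exists M => n; apply: le_trans (normc_Im_le _) (cM n). Qed.

Lemma bounded_cseqD c d : bounded_cseq c -> bounded_cseq d ->
  bounded_cseq (fun n => c n + d n).
Proof.
move=> [M cM] [N dN]; exists (M + N) => n.
by rewrite (le_trans (ler_normcD _ _))// lerD.
Qed.

Lemma bounded_cseqM c d : bounded_cseq c -> bounded_cseq d ->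
  bounded_cseq (fun n => c n * d n).
Proof.
move=> [M cM] [N dN]; exists (M * N) => n.
by rewrite normcM ler_pM ?normc_ge0.
Qed.

Lemma bounded_cseq_cst z : bounded_cseq (fun=> z).
Proof. by exists (normc z) => n. Qed.

Lemma bounded_cseqX c m : bounded_cseq c -> bounded_cseq (fun n => c n ^+ m).
Proof.
move=> bc; elim: m => [|m IH].
  exact: (bounded_cseq_cst 1).
have := bounded_cseqM bc IH; congr bounded_cseq.
by apply/funext => n; rewrite exprS.
Qed.

Lemma cwsumD c d : bounded_cseq c -> bounded_cseq d ->
  cwsum (fun n => c n + d n) = cwsum c + cwsum d.
Proof.
move=> bc bd; rewrite /cwsum.
have RD : (fun n => complex.Re (c n + d n)) =
    (fun n => complex.Re (c n) + complex.Re (d n)).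
  by apply/funext => n; case: (c n) (d n) => [? ?] [].
have ID : (fun n => complex.Im (c n + d n)) =
    (fun n => complex.Im (c n) + complex.Im (d n)).
  by apply/funext => n; case: (c n) (d n) => [? ?] [].
rewrite RD ID !(wsumD a_gt0 a_sum)//; try exact: bounded_Re; exact: bounded_Im.
Qed.

Lemma cwsumZ z c : bounded_cseq c -> cwsum (fun n => z * c n) = z * cwsum c.
Proof.
move=> bc; have bR := bounded_Re bc; have bI := bounded_Im bc.
case: z => x y; rewrite /cwsum.
have RM : (fun n => complex.Re (Complex x y * c n)) =
    (fun n => x * complex.Re (c n) + (- y) * complex.Im (c n)).
  by apply/funext => n; case: (c n) => u v /=; ring.
have IM : (fun n => complex.Im (Complex x y * c n)) =
    (fun n => x * complex.Im (c n) + y * complex.Re (c n)).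
  by apply/funext => n; case: (c n) => u v /=; ring.
have bM s e : bounded_seq e -> bounded_seq (fun n => s * e n).
  exact: (bounded_seqM (bounded_seq_cst s)).
rewrite RM IM !(wsumD a_gt0 a_sum) ?(wsumZ a_gt0 a_sum)//; try exact: bM.
by apply/eqP; rewrite eq_complex /=; apply/andP; split; apply/eqP; ring.
Qed.

Lemma normc_cwsum_le c M : (forall n, normc (c n) <= M) ->
  normc (cwsum c) <= 2 * (M * wsum a (fun=> 1)).
Proof.
move=> cM; apply: le_trans (normc_le_ReIm _) _; rewrite mulr2n mulrDl !mul1r.
apply: lerD; apply: ler_norm_wsum => // n.
  exact: le_trans (normc_Re_le _) (cM n).
exact: le_trans (normc_Im_le _) (cM n).
Qed.

Lemma cvg_complex (u : nat -> R[i]) (l : R[i]) :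
  complex.Re (u n) @[n --> \oo] --> complex.Re l ->
  complex.Im (u n) @[n --> \oo] --> complex.Im l ->
  (u : nat -> R[i]^o) @ \oo --> (l : R[i]^o).
Proof.
move=> /cvgrPdist_lt uR /cvgrPdist_lt uI; apply/cvgrPdist_lt => e e0.
(* In [R[i]], [0 < e] forces [e] to be real, so the radius can be replaced by its real part. *)
have e0' : 0 < complex.Re e by move: e0; rewrite ltcE => /andP[].
have eE : e = (complex.Re e)%:C.
  by case: e e0 {e0'} => x y; rewrite ltcE /= => /andP[/eqP-> _].
have e20 : 0 < complex.Re e / 2 by rewrite divr_gt0.
have /= HR := uR _ e20; have /= HI := uI _ e20.
apply: filterS2 HR HI => n HR HI.
rewrite normcE_complex eE ltcR; apply: le_lt_trans (normc_le_ReIm _) _.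
rewrite [ltRHS](splitr (complex.Re e)) ltrD//.
  by case: l (u n) HR {uR uI HI} => ? ? [].
by case: l (u n) HI {uR uI HR} => ? ? [].
Qed.

Lemma limn_cwsum c : bounded_cseq c ->
  limn (series (fun n => (a n)%:C * c n : R[i]^o)) = cwsum c.
Proof.
move=> bc; apply: cvg_lim; first exact: norm_hausdorff.
have sumRe (m : nat) : complex.Re (series (fun n => (a n)%:C * c n) m) =
    series (fun n => a n * complex.Re (c n)) m.
  elim: m => [|m IH]; first by rewrite /series/= !big_geq.
  by rewrite !seriesSr -IH; case: (series _ m) (c m) => [? ?] [? ?]/=; ring.
have sumIm (m : nat) : complex.Im (series (fun n => (a n)%:C * c n) m) =
    series (fun n => a n * complex.Im (c n)) m.
  elim: m => [|m IH]; first by rewrite /series/= !big_geq.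
  by rewrite !seriesSr -IH; case: (series _ m) (c m) => [? ?] [? ?]/=; ring.
apply: cvg_complex.
  by under eq_fun do rewrite sumRe; apply: wsum_cvg => //; exact: bounded_Re.
by under eq_fun do rewrite sumIm; apply: wsum_cvg => //; exact: bounded_Im.
Qed.

End ComplexWeightedSum.

(** * Derivatives from quadratic remainders *)

Lemma derive1_quadratic (K : numFieldType) (f : K -> K^o) (z D e C : K) :
  0 < e -> (forall h, `|h| < e -> `|f (h + z) - f z - h * D| <= C * `|h| ^+ 2) ->
  derive1 f z = D.
Proof.
move=> e0 fC; apply: cvg_lim; first exact: norm_hausdorff.
(* The bound at the admissible increment [e / 2] forces [C] to be nonnegative. *)
have C0 : 0 <= C.
  have e20 : 0 < e / 2 by rewrite divr_gt0.
  have /fC : `|e / 2| < e by rewrite gtr0_norm// ltr_pdivrMr// ltr_pMr// ltr1n.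
  by move/(le_trans (normr_ge0 _)); rewrite pmulr_lge0// exprn_gt0// normr_gt0 gt_eqF.
apply/cvgrPdist_le => eps eps0; near=> h.
have h0 : h != 0 by near: h; exact: nbhs_dnbhs_neq.
have he : `|h| < e.
  near: h; apply: nbhs_dnbhs; apply/nbhs_ballP; exists e => //= y.
  by rewrite /ball/= sub0r normrN.
(* Dividing by [C + 1] rather than [C] allows [C = 0]. *)
have hE : `|h| < eps / (C + 1).
  near: h; apply: nbhs_dnbhs; apply/nbhs_ballP.
  exists (eps / (C + 1)); first by rewrite /= divr_gt0// ltr_wpDl.
  by move=> y; rewrite /ball/= sub0r normrN.
have h0' : 0 < `|h| by rewrite normr_gt0.
have -> : D - h^-1 *: (f (h + z) - f z) = - (h^-1 * (f (h + z) - f z - h * D)).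
  by rewrite /GRing.scale/=; field.
rewrite normrN normrM normfV ler_pdivrMl//.
apply: le_trans (fC _ he) _; rewrite expr2 mulrCA ler_pM2l//.
apply: le_trans (_ : (C + 1) * `|h| <= _); first by rewrite ler_pM2r// lerDl.
by rewrite mulrC -ler_pdivlMr ?ltW// ltr_wpDl.
Unshelve. all: by end_near.
Qed.

(** * Expansion and derivatives of PH off the poles *)

Section SeparatedPoles.
Set Implicit Arguments.
Unset Strict Implicit.
Variables (R : realType) (b k : nat -> R) (d : R).
Hypotheses (b_gt0 : forall n, 0 < b n) (b_sum : cvgn (series b)).
Hypotheses (d_gt0 : 0 < d) (k_sep : forall m n, m != n -> d <= `|k m - k n|).
Import Normc.

Definition weight n := 4 * b n.

Lemma weight_gt0 n : 0 < weight n.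
Proof. by rewrite mulr_gt0. Qed.

Lemma weight_sum : cvgn (series weight).
Proof. exact: is_cvg_seriesZ b_sum. Qed.

Definition off_poles (z : R[i]) := forall n, z <> (k n)%:C.

Definition pole_inv (z : R[i]) (n : nat) : R[i] := (z - (k n)%:C)^-1.

(** By the triangle inequality, at most one pole lies closer than [d / 2] to [z]; the minimum of
    [d / 2] and the distance to that pole works. *)
Lemma off_poles_dist z : off_poles z ->
  exists2 e, 0 < e & forall n, e <= normc (z - (k n)%:C).
Proof.
move=> zk; have d2 : 0 < d / 2 by rewrite divr_gt0.
have [[n zn]|nz] := pselect (exists n, normc (z - (k n)%:C) < d / 2); last first.
  by exists (d / 2) => // n; rewrite leNgt; apply/negP => ?; apply: nz; exists n.
have zn0 : 0 < normc (z - (k n)%:C).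
  rewrite lt_def normc_ge0 andbT; apply/eqP => /eq0_normc/eqP.
  by rewrite subr_eq0 => /eqP/zk.
exists (Num.min (d / 2) (normc (z - (k n)%:C))).
  by rewrite lt_min d2.
move=> m; rewrite ge_min; have [->|mn] := eqVneq m n; first by rewrite lexx orbT.
apply/orP; left; rewrite leNgt; apply/negP => zm.
have := k_sep mn; apply/negP; rewrite -ltNge (splitr d).
have -> : `|k m - k n| = normc ((z - (k n)%:C) + - (z - (k m)%:C)).
  by rewrite -normc_real; congr normc; rewrite rmorphB /=; ring.
by apply: le_lt_trans (ler_normcD _ _) _; rewrite normcN ltrD.
Qed.

Lemma pole_inv_le z e n : 0 < e -> e <= normc (z - (k n)%:C) ->
  normc (pole_inv z n) <= e^-1.
Proof.
move=> e0 ez; rewrite /pole_inv normcV lef_pV2 ?posrE//.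
exact: lt_le_trans ez.
Qed.

Lemma bounded_pole_inv z : off_poles z -> bounded_cseq (pole_inv z).
Proof. by move=> /off_poles_dist[e e0 ze]; exists e^-1 => n; exact: pole_inv_le. Qed.

(** Off the poles [PH] is [z + moment 1 z], and differentiating [moment m] gives [- m] times
    [moment m.+1], so every derivative needed is expressed by moments. *)
Definition moment (m : nat) (z : R[i]) : R[i] :=
  cwsum weight (fun n => pole_inv z n ^+ m).

Lemma PHE z : off_poles z -> PH b k z = z + moment 1 z.
Proof.
move=> zk; rewrite /PH /moment -(limn_cwsum weight_gt0 weight_sum)//.
by apply: bounded_cseqX; exact: bounded_pole_inv.
Qed.

(* First order expansion of x |-> x^-m, with a remainder uniform in the point. *)
Lemma inv_pow_expansion m (D : R) : 0 <= D -> exists2 C, 0 <= C &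
  forall w z : R[i], w != 0 -> z != 0 -> normc w^-1 <= D -> normc z^-1 <= D ->
  normc (w^-1 ^+ m - z^-1 ^+ m + m%:R * (w - z) * z^-1 ^+ m.+1)
    <= C * normc (w - z) ^+ 2.
Proof.
move=> D0; elim: m => [|m [C C0 IH]].
  exists 0 => // w z w0 z0 _ _.
  by rewrite !expr0 subrr add0r !mul0r normc0.
(* Read off the identity below: the remainder for [m] times [w^-1], plus an exact multiple of
   [(w - z) ^+ 2]. *)
exists (D * C + m.+1%:R * (D * D ^+ m.+2)).
  have Dm : 0 <= D ^+ m.+2 by exact: exprn_ge0.
  by apply: addr_ge0; [exact: mulr_ge0|apply: mulr_ge0 => //; exact: mulr_ge0].
move=> w z w0 z0 wD zD.
have -> : w^-1 ^+ m.+1 - z^-1 ^+ m.+1 + m.+1%:R * (w - z) * z^-1 ^+ m.+2 =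
    w^-1 * (w^-1 ^+ m - z^-1 ^+ m + m%:R * (w - z) * z^-1 ^+ m.+1) +
    (w - z) ^+ 2 * (m.+1%:R * (w^-1 * z^-1 ^+ m.+2)).
  rewrite -natr1 !exprS; move: (w^-1 ^+ m) (z^-1 ^+ m) => X Y.
  by field; rewrite w0 z0.
apply: le_trans (ler_normcD _ _) _; rewrite mulrDl lerD//.
  by rewrite normcM -[leRHS]mulrA; apply: ler_pM; rewrite ?normc_ge0//; exact: IH.
rewrite normcM normcX mulrC ler_wpM2r ?exprn_ge0 ?normc_ge0//.
have -> : (m.+1%:R : R[i]) = (m.+1%:R : R)%:C by rewrite rmorph_nat.
rewrite normcM normc_real ger0_norm// ler_wpM2l// normcM normcX.
by rewrite ler_pM ?exprn_ge0 ?normc_ge0// lerXn2r ?nnegrE ?normc_ge0.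
Qed.

Lemma moment_expansion m z : off_poles z -> exists e C,
  [/\ 0 < e, 0 <= C & forall h, normc h < e -> off_poles (h + z) /\
    normc (moment m (h + z) - moment m z + m%:R * h * moment m.+1 z)
      <= C * normc h ^+ 2].
Proof.
move=> zk; have [e e0 ze] := off_poles_dist zk.
have e20 : 0 < e / 2 by rewrite divr_gt0.
have D0 : 0 <= (e / 2)^-1 by rewrite invr_ge0 ltW.
have [C C0 CE] := inv_pow_expansion m D0.
(* An increment shorter than half the distance [e] to the poles keeps [h + z] at distance [e / 2]
   from all of them, so one constant [C] serves every term; the factor 2 comes from
   [normc_cwsum_le]. *)
exists (e / 2), (2 * (C * wsum weight (fun=> 1))); split=> //.
  rewrite !mulr_ge0// (wsum_ge0 weight_gt0 weight_sum)//.
  exact: bounded_seq_cst.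
move=> h he.
have hz n : e / 2 <= normc (h + z - (k n)%:C).
  have : e <= normc (h + z - (k n)%:C) + normc (- h).
    apply: le_trans (ze n) _; apply: le_trans (ler_normcD _ _).
    by rewrite le_eqVlt; apply/orP; left; apply/eqP; congr normc; ring.
  by rewrite normcN; lra.
have hzk : off_poles (h + z).
  by move=> n hzn; have := hz n; rewrite hzn subrr normc0 leNgt e20.
split=> //.
have bz := bounded_pole_inv zk; have bhz := bounded_pole_inv hzk.
have b1 := bounded_cseqX m bhz; have b2 := bounded_cseqX m bz.
have b3 := bounded_cseqX m.+1 bz.
have bc (x : R[i]) c : bounded_cseq c -> bounded_cseq (fun n => x * c n).
  exact: (bounded_cseqM (bounded_cseq_cst x)).
have -> : moment m (h + z) - moment m z + m%:R * h * moment m.+1 z =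
   cwsum weight (fun n => (pole_inv (h + z) n ^+ m + (- 1) * pole_inv z n ^+ m) +
                   (m%:R * h) * pole_inv z n ^+ m.+1).
  have H := cwsumD weight_gt0 weight_sum; have HZ := cwsumZ weight_gt0 weight_sum.
  rewrite !H ?HZ ?mulN1r//; try exact: bc.
  by apply: bounded_cseqD => //; exact: bc.
rewrite -[leRHS]mulrA [X in _ <= 2 * X]mulrAC; apply: normc_cwsum_le => [||n].
- exact: weight_gt0.
- exact: weight_sum.
- have sub0 (w : R[i]) : (forall n, w <> (k n)%:C) -> w - (k n)%:C != 0.
    by move=> wk; rewrite subr_eq0; apply/eqP.
  have := CE _ _ (sub0 _ hzk) (sub0 _ zk) (pole_inv_le e20 (hz n))
    (pole_inv_le e20 (le_trans _ (ze n))).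
  have -> : h + z - (k n)%:C - (z - (k n)%:C) = h by ring.
  by rewrite mulN1r; apply; rewrite ler_pdivrMr// ler_pMr// ler1n.
Qed.

(** Agreement of [f] with the formula off the poles is enough, because small increments stay off the
    poles. The formula for one iterated derivative therefore yields the next. *)
Lemma derive1_moment (f : R[i] -> R[i]^o) (c s : R[i]) m :
  (forall z, off_poles z -> f z = c + s * moment m z) ->
  forall z, off_poles z -> derive1 f z = - (s * m%:R * moment m.+1 z).
Proof.
move=> fE z zk; have [e [C [e0 C0 CE]]] := moment_expansion m zk.
apply: (@derive1_quadratic _ _ _ _ e%:C (normc s * C)%:C).
  by rewrite ltcR.
move=> h; rewrite normcE_complex ltcR => /CE[hzk hC].
rewrite !fE// -rmorphXn -rmorphM /= normcE_complex lecR.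
have -> : c + s * moment m (h + z) - (c + s * moment m z) -
      h * - (s * m%:R * moment m.+1 z) =
    s * (moment m (h + z) - moment m z + m%:R * h * moment m.+1 z) by ring.
by rewrite normcM -[leRHS]mulrA ler_wpM2l ?normc_ge0.
Qed.

Lemma dPH1E z : off_poles z -> dPH b k 1 z = 1 - moment 2 z.
Proof.
move=> zk; have [e [C [e0 C0 CE]]] := moment_expansion 1 zk.
apply: (@derive1_quadratic _ _ _ _ e%:C C%:C); first by rewrite ltcR.
move=> h; rewrite normcE_complex ltcR => /CE[hzk hC].
rewrite !PHE// -rmorphXn -rmorphM /= normcE_complex lecR.
apply: le_trans hC; rewrite le_eqVlt; apply/orP; left; apply/eqP; congr normc.
by ring.
Qed.

Lemma dPH2E z : off_poles z -> dPH b k 2 z = 2 * moment 3 z.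
Proof.
have fE w : off_poles w -> dPH b k 1 w = 1 + (-1) * moment 2 w.
  by move=> wk; rewrite dPH1E// mulN1r.
by move=> zk; rewrite -[LHS]/(derive1 (dPH b k 1) z) (derive1_moment fE)//; ring.
Qed.

Lemma dPH3E z : off_poles z -> dPH b k 3 z = - (6 * moment 4 z).
Proof.
have fE w : off_poles w -> dPH b k 2 w = 0 + 2 * moment 3 w.
  by move=> wk; rewrite dPH2E// add0r.
by move=> zk; rewrite -[LHS]/(derive1 (dPH b k 2) z) (derive1_moment fE)//; ring.
Qed.

(* Equals [1 - PH'] at a real point. *)
Definition gain (z : R[i]) : R := wsum weight (fun n => normc (pole_inv z n) ^+ 2).

(** * Pairs of roots and non-real roots *)

Lemma pole_inv_sub z w n : off_poles z -> off_poles w ->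
  pole_inv z n - pole_inv w n = (w - z) * (pole_inv z n * pole_inv w n).
Proof.
move=> zk wk; rewrite /pole_inv; field.
by rewrite !subr_eq0; apply/andP; split; apply/eqP; (exact: zk || exact: wk).
Qed.

Lemma PH_rootE z : PH_root b k z <-> off_poles z /\ z + moment 1 z = 0.
Proof.
split=> [[zk]|[zk z0]]; first by rewrite PHE.
by split=> //; rewrite PHE.
Qed.

(** The difference [moment 1 z - moment 1 w] is [w - z] times this sum, and the two root equations
    make it equal to [w - z], which can be cancelled. *)
Lemma cwsum_root_pair z w : PH_root b k z -> PH_root b k w -> z <> w ->
  cwsum weight (fun n => pole_inv z n * pole_inv w n) = 1.
Proof.
move=> /PH_rootE[zk z0] /PH_rootE[wk w0] /eqP zw.
have bz := bounded_pole_inv zk; have bw := bounded_pole_inv wk.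
have bzw := bounded_cseqM bz bw.
have wz0 : w - z != 0 by rewrite subr_eq0 eq_sym.
apply: (mulfI wz0); rewrite mulr1 -(cwsumZ weight_gt0 weight_sum)//.
under [fun n => _]eq_fun do rewrite -pole_inv_sub//.
have bN : bounded_cseq (fun n => (-1) * pole_inv w n).
  exact: bounded_cseqM (bounded_cseq_cst _) bw.
under [fun n => _]eq_fun do rewrite -mulN1r.
rewrite (cwsumD weight_gt0 weight_sum)// (cwsumZ weight_gt0 weight_sum)//.
have m1 v : cwsum weight (pole_inv v) = moment 1 v by [].
rewrite !m1 mulN1r; move/eqP : z0; rewrite addrC addr_eq0 => /eqP ->.
by move/eqP : w0; rewrite addrC addr_eq0 => /eqP ->; ring.
Qed.

Lemma bounded_normc_sqr z : off_poles z ->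
  bounded_seq (fun n => normc (pole_inv z n) ^+ 2).
Proof.
move=> /bounded_pole_inv[M zM]; exists (M ^+ 2) => n.
by rewrite ger0_norm ?exprn_ge0 ?normc_ge0// lerXn2r ?nnegrE ?normc_ge0
  ?(le_trans _ (zM n)) ?normc_ge0.
Qed.

Lemma sqr_normc_complex (x y : R) : normc (Complex x y) ^+ 2 = x ^+ 2 + y ^+ 2.
Proof. by rewrite /= sqr_sqrtr// addr_ge0 ?sqr_ge0. Qed.

(* The difference of the two sides is the weighted sum of
   [|1/(z - k_n) - conj (1/(w - k_n))|^2]. *)
Lemma gain_pair z w : PH_root b k z -> PH_root b k w -> z <> w -> z <> conjc w ->
  2 < gain z + gain w.
Proof.
move=> rz rw zw zcw.
have [zk _] := (PH_rootE z).1 rz; have [wk _] := (PH_rootE w).1 rw.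
have bz := bounded_normc_sqr zk; have bw := bounded_normc_sqr wk.
have bR := bounded_Re (bounded_cseqM (bounded_pole_inv zk) (bounded_pole_inv wk)).
have := congr1 (@complex.Re R) (cwsum_root_pair rz rw zw) => /= H.
have {H}-> :
    2 = 2 * wsum weight (fun n => complex.Re (pole_inv z n * pole_inv w n)).
  by rewrite H mulr1.
rewrite -subr_gt0 -mulNr /gain.
rewrite -(wsumZ weight_gt0 weight_sum)// -!(wsumD weight_gt0 weight_sum)//; last 2 first.
- exact: bounded_seqD.
- exact: bounded_seqM (bounded_seq_cst _) bR.
apply: (wsum_gt0 weight_gt0 weight_sum).
  by apply: bounded_seqD; [exact: bounded_seqD|exact: bounded_seqM (bounded_seq_cst _) bR].
move=> n.
(* Strictness: inversion is injective and the poles are real, so equality here would force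
   [z = conjc w]. *)
have neq : pole_inv z n <> conjc (pole_inv w n).
  rewrite /pole_inv conjc_inv => /invr_inj; rewrite rmorphB /= oppr0 => zE.
  by apply: zcw; exact: addIr zE.
case: (pole_inv z n) (pole_inv w n) neq => [x y] [u v] neq.
rewrite !sqr_normc_complex /=.
rewrite [ltRHS](_ : _ = (x - u) ^+ 2 + (y + v) ^+ 2); last by ring.
rewrite lt_def addr_ge0 ?sqr_ge0// andbT paddr_eq0 ?sqr_ge0// !sqrf_eq0.
apply/negP => /andP[]; rewrite subr_eq0 addr_eq0 => /eqP xu /eqP yv.
by apply: neq; rewrite /= xu yv.
Qed.

Lemma off_poles_conj z : off_poles z -> off_poles (conjc z).
Proof.
move=> zk n zn; apply: (zk n); rewrite -[z]conjcK zn.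
by rewrite /= oppr0.
Qed.

Lemma pole_inv_conj z n : pole_inv (conjc z) n = conjc (pole_inv z n).
Proof. by rewrite /pole_inv conjc_inv rmorphB /= oppr0. Qed.

Lemma moment_conj m z : off_poles z -> moment m (conjc z) = conjc (moment m z).
Proof.
move=> zk; have bz := bounded_cseqX m (bounded_pole_inv zk).
have E : (fun n => pole_inv (conjc z) n ^+ m) =
         (fun n => conjc (pole_inv z n ^+ m)).
  by apply/funext => n; rewrite pole_inv_conj rmorphXn.
rewrite /moment E /cwsum; apply/eqP; rewrite eq_complex /=.
apply/andP; split; apply/eqP.
  by congr wsum; apply/funext => n; case: (_ ^+ m).
rewrite -(wsumN weight_gt0 weight_sum); last exact: bounded_Im.
by congr wsum; apply/funext => n; case: (_ ^+ m).
Qed.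

Lemma PH_root_conj z : PH_root b k z -> PH_root b k (conjc z).
Proof.
move=> /PH_rootE[zk z0]; apply/PH_rootE; split; first exact: off_poles_conj.
by rewrite moment_conj// -rmorphD z0 rmorph0.
Qed.

(** Pair the root [z] with the distinct root [conjc z] in [cwsum_root_pair]: each product becomes a
    squared modulus. *)
Lemma gain_nonreal z : complex.Im z <> 0 -> PH_root b k z -> gain z = 1.
Proof.
move=> Iz rz; have zcz : z <> conjc z.
  by case: z {rz} Iz => x y /= y0 [] yE; apply: y0; lra.
have := cwsum_root_pair rz (PH_root_conj rz) zcz.
move=> /(congr1 (@complex.Re R)) /= <-; congr wsum; apply/funext => n.
rewrite pole_inv_conj; case: (pole_inv z n) => x y.
by rewrite sqr_normc_complex /=; ring.
Qed.

(** Since [gain z = 1], the real part of the derivative is the weighted sum of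
    [|u|^2 - Re (u^2) = 2 (Im u)^2] with [u = 1 / (z - k n)], and [Im u] is nonzero for non-real
    [z]. *)
Lemma dPH1_nonreal_root z : complex.Im z <> 0 -> PH_root b k z -> dPH b k 1 z <> 0.
Proof.
move=> Iz rz; have [zk _] := (PH_rootE z).1 rz.
have bz := bounded_normc_sqr zk.
have bR := bounded_Re (bounded_cseqX 2 (bounded_pole_inv zk)).
rewrite dPH1E// => /(congr1 (@complex.Re R)).
have -> : complex.Re (1 - moment 2 z) = 1 - complex.Re (moment 2 z).
  by case: (moment 2 z).
rewrite -(gain_nonreal Iz rz) /gain /moment /=; apply/eqP.
rewrite -(wsumN weight_gt0 weight_sum)// -(wsumD weight_gt0 weight_sum)//;
  last exact: bounded_seqN.
rewrite gt_eqF//; apply: (wsum_gt0 weight_gt0 weight_sum).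
  by apply: bounded_seqD => //; exact: bounded_seqN.
move=> n.
have : complex.Im (pole_inv z n) <> 0.
  rewrite /pole_inv; case: z {rz zk bz bR} Iz => x y /= y0; apply/eqP.
  rewrite oppr0 addr0 oppr_eq0 mulf_neq0//; first exact/eqP.
  rewrite invr_eq0 gt_eqF// ltr_wpDl ?sqr_ge0// exprn_even_gt0//=.
  exact/eqP.
case: (pole_inv z n) => x y /= /eqP y0; rewrite sqr_sqrtr ?addr_ge0 ?sqr_ge0//.
have -> : x ^+ 2 + y ^+ 2 - (x * x - y * y) = 2 * y ^+ 2 by ring.
by rewrite mulr_gt0// exprn_even_gt0.
Qed.

End SeparatedPoles.

(** * Divided differences on an interval without poles *)

Section DividedDifferences.
Set Implicit Arguments.
Unset Strict Implicit.
Variables (R : realType) (a k : nat -> R) (d : R).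
Hypotheses (a_gt0 : forall n, 0 < a n) (a_sum : cvgn (series a)).
Hypotheses (d_gt0 : 0 < d) (k_sep : forall m n, m != n -> d <= `|k m - k n|).

Definition off (x : R) := forall n, x <> k n.

Definition rinv (x : R) (n : nat) : R := (x - k n)^-1.

Lemma rinv_bounded x : off x -> bounded_seq (rinv x).
Proof.
move=> xk; have /(bounded_pole_inv d_gt0 k_sep)/bounded_Re : off_poles k x%:C.
  by move=> n /complexI/xk.
congr bounded_seq; apply/funext => n; rewrite /pole_inv -rmorphB -fmorphV.
by [].
Qed.

Definition pfun (x : R) : R := x + wsum a (rinv x).
(** [pdiff2], [pdiff3] and [pdiff4] are the divided differences of [pfun] at two, three and four
    points. Written as sums they also make sense at coinciding points, where they are the first
    derivative, half the second and a sixth of the third. *)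
Definition pdiff2 (x y : R) : R := 1 - wsum a (fun n => rinv x n * rinv y n).
Definition pdiff3 (x y z : R) : R :=
  wsum a (fun n => rinv x n * rinv y n * rinv z n).
Definition pdiff4 (x y z w : R) : R :=
  - wsum a (fun n => rinv x n * rinv y n * rinv z n * rinv w n).

Lemma pdiff2C x y : pdiff2 x y = pdiff2 y x.
Proof. by congr (1 - wsum _ _); apply/funext => n; rewrite mulrC. Qed.

Lemma pdiff3C x y z : pdiff3 x y z = pdiff3 y x z.
Proof. by congr wsum; apply/funext => n; congr (_ * _); rewrite mulrC. Qed.

Lemma pdiff3AC x y z : pdiff3 x y z = pdiff3 x z y.
Proof. by congr wsum; apply/funext => n; rewrite mulrAC. Qed.

(** Termwise, [1 / (x - k) - 1 / (y - k) = (y - x) / ((x - k) (y - k))]. The factor [c] carries the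
    remaining points, so this one identity gives the recursion for all orders of divided
    differences. *)
Lemma wsum_rinv_sub c x y : bounded_seq c -> off x -> off y ->
  wsum a (fun n => c n * rinv x n) - wsum a (fun n => c n * rinv y n) =
  (y - x) * wsum a (fun n => c n * rinv x n * rinv y n).
Proof.
move=> bc xk yk.
have bx := bounded_seqM bc (rinv_bounded xk).
have bY := bounded_seqM bc (rinv_bounded yk).
have bxy := bounded_seqM bx (rinv_bounded yk).
rewrite -(wsumZ a_gt0 a_sum)// -(wsumN a_gt0 a_sum)//
  -(wsumD a_gt0 a_sum)//; last exact: bounded_seqN.
congr wsum; apply/funext => n; rewrite /rinv; field.
by rewrite !subr_eq0; apply/andP; split; apply/eqP; (exact: xk || exact: yk).
Qed.

Lemma pfun_sub x y : off x -> off y -> pfun x - pfun y = (x - y) * pdiff2 x y.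
Proof.
move=> xk yk; have := wsum_rinv_sub (bounded_seq_cst 1) xk yk.
under [fun n => 1 * rinv x n]eq_fun do rewrite mul1r.
under [fun n => 1 * rinv y n]eq_fun do rewrite mul1r.
under [fun n => 1 * rinv x n * rinv y n]eq_fun do rewrite mul1r.
by rewrite /pfun /pdiff2 => H; rewrite mulrBr mulr1 -(opprB y x) mulNr -H; ring.
Qed.

Lemma pdiff2_sub x y z : off x -> off y -> off z ->
  pdiff2 x y - pdiff2 x z = (y - z) * pdiff3 x y z.
Proof.
move=> xk yk zk; have := wsum_rinv_sub (rinv_bounded xk) yk zk.
by rewrite /pdiff2 /pdiff3 => H; rewrite -(opprB z y) mulNr -H; ring.
Qed.

Lemma pdiff3_sub x y z w : off x -> off y -> off z -> off w ->
  pdiff3 x y z - pdiff3 x y w = (z - w) * pdiff4 x y z w.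
Proof.
move=> xk yk zk wk.
have := wsum_rinv_sub (bounded_seqM (rinv_bounded xk) (rinv_bounded yk)) zk wk.
by rewrite /pdiff3 /pdiff4 => ->; ring.
Qed.

(** Every pole lies on one side of [[l, r]], so [|rinv x n|] is at most its value at the end nearest
    that pole; this bounds [rinv] uniformly and [wsum_rinv_sub] concludes. *)
Lemma lipschitz_rinv c l r : bounded_seq c ->
  (forall n, k n < l \/ r < k n) ->
  exists M, forall x y, l <= x <= r -> l <= y <= r ->
    `|wsum a (fun n => c n * rinv x n) - wsum a (fun n => c n * rinv y n)|
      <= M * `|x - y|.
Proof.
move=> bc lr.
have [lr'|rl] := leP l r; last first.
  by exists 0 => x y /andP[lx xr]; have := le_trans lx xr; rewrite leNgt rl.
have inoff x : l <= x <= r -> off x.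
  move=> /andP[lx xr] n xk; case: (lr n); rewrite -xk ltNge.
  - by rewrite lx.
  - by rewrite xr.
have [Ml lM] := rinv_bounded (inoff l (introT andP (conj (lexx l) lr'))).
have [Mr rM] := rinv_bounded (inoff r (introT andP (conj lr' (lexx r)))).
have [C cC] := bc.
have rinvM x n : l <= x <= r -> `|rinv x n| <= Ml + Mr.
  move=> /andP[lx xr]; have Ml0 := le_trans (normr_ge0 _) (lM n).
  have Mr0 := le_trans (normr_ge0 _) (rM n).
  case: (lr n) => kn.
    apply: le_trans (_ : `|rinv l n| <= _); last by rewrite (le_trans (lM n))// lerDl.
    rewrite /rinv !normfV lef_pV2 ?posrE ?normr_gt0 ?subr_eq0 ?gt_eqF//.
      by rewrite !ger0_norm ?subr_ge0 ?lerD2r// ?(ltW kn)// (le_trans (ltW kn)).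
    exact: lt_le_trans lx.
  apply: le_trans (_ : `|rinv r n| <= _); last by rewrite (le_trans (rM n))// lerDr.
  rewrite /rinv !normfV lef_pV2 ?posrE ?normr_gt0 ?subr_eq0 ?lt_eqF//.
    by rewrite !ler0_norm ?subr_le0 ?lerN2 ?lerD2r// ?(ltW kn)// (le_trans _ (ltW kn)).
  exact: le_lt_trans kn.
exists (C * (Ml + Mr) * (Ml + Mr) * wsum a (fun=> 1)) => x y xI yI.
rewrite wsum_rinv_sub//; [|exact: inoff..].
rewrite normrM distrC mulrC ler_wpM2r//.
apply: ler_norm_wsum => // n.
by rewrite !normrM !ler_pM// rinvM.
Qed.

Lemma lipschitz_IVT (f : R -> R) l r M : l <= r ->
  (forall x y, l <= x <= r -> l <= y <= r -> `|f x - f y| <= M * `|x - y|) ->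
  f l * f r <= 0 -> exists2 x, l <= x <= r & f x = 0.
Proof.
move=> lr fM flr.
have fc : {within `[l, r], continuous f}.
  apply/subspace_continuousP => x xI; apply/cvgrPdist_le => e e0.
  have M1 : 0 < `|M| + 1 by rewrite ltr_wpDl.
  rewrite near_withinE; near=> y => yI.
  apply: le_trans (fM _ _ _ _) _; [by move: xI; rewrite /= in_itv|
    by move: yI; rewrite /= in_itv|].
  (* [M] is not known to be positive; [|M| + 1] is, and can be divided by. *)
  apply: le_trans (_ : (`|M| + 1) * `|x - y| <= _).
    by rewrite ler_wpM2r// (le_trans (ler_norm M))// lerDl.
  rewrite mulrC -ler_pdivlMr//; near: y.
  by apply: cvgr_dist_le; [exact: cvg_id|rewrite divr_gt0].
have [] := @IVT R f l r 0 lr fc.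
  rewrite ge_min le_max; apply/andP; split.
    by have [//|fl] := leP (f l) 0; rewrite -(pmulr_rle0 _ fl).
  by have [//|fl] := leP 0 (f l); rewrite -(nmulr_rle0 _ fl).
by move=> c; rewrite in_itv /=; exists c.
Unshelve. all: by end_near.
Qed.

(** A convex set on which each [x - k n] keeps a fixed sign; taking [x = y] in the first clause
    shows that it avoids the poles. *)
Definition pole_span (I : set R) :=
  (forall x y n, I x -> I y -> 0 < (x - k n) * (y - k n)) /\
  (forall x y z, I x -> I y -> x <= z <= y -> I z).

Lemma span_off I x : pole_span I -> I x -> off x.
Proof. by move=> [I0 _] Ix n xn; have := I0 x x n Ix Ix; rewrite xn subrr mul0r ltxx. Qed.

(** The four factors group into two pairs, each of positive product. *)
Lemma pdiff4_lt0 I x y z w : pole_span I -> I x -> I y -> I z -> I w ->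
  pdiff4 x y z w < 0.
Proof.
move=> sI Ix Iy Iz Iw; rewrite oppr_lt0; apply: (wsum_gt0 a_gt0 a_sum).
  by do 3 (apply: bounded_seqM; last exact: rinv_bounded (span_off sI _));
    exact: rinv_bounded (span_off sI _).
move=> n; rewrite -mulrA mulr_gt0// /rinv -invfM invr_gt0 mulrC; exact: sI.1.
Qed.

(** The affine part and the factor [c] let one intermediate value argument serve [pfun], [pdiff2]
    and [pdiff3], seen as functions of their last argument. *)
Lemma span_zero I A B s c l r : pole_span I -> bounded_seq c ->
  I l -> I r -> l <= r ->
  let f w := A * w + B + s * wsum a (fun n => c n * rinv w n) in
  f l * f r <= 0 -> exists2 x, I x & f x = 0.
Proof.
move=> sI bc Il Ir lr f flr.
have lrk n : k n < l \/ r < k n.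
  have [kl|lk|kl] := ltgtP (k n) l; first by left.
    by right; have := sI.1 l r n Il Ir; rewrite nmulr_rgt0 ?subr_lt0.
  by have := span_off sI Il; move=> /(_ n); rewrite kl.
have [M fM] := lipschitz_rinv bc lrk.
have [x xlr fx] : exists2 x, l <= x <= r & f x = 0.
  apply: (@lipschitz_IVT f l r (`|A| + `|s| * M)) => // x y xI yI.
  have -> : f x - f y = A * (x - y) + s * (wsum a (fun n => c n * rinv x n) -
      wsum a (fun n => c n * rinv y n)) by rewrite /f; ring.
  apply: le_trans (ler_normD _ _) _; rewrite !normrM mulrDl lerD// -mulrA.
  by rewrite ler_wpM2l// fM.
by exists x => //; apply: (sI.2 l r).
Qed.

Lemma pfunE x : pfun x = 1 * x + 0 + 1 * wsum a (fun n => 1 * rinv x n).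
Proof. by under [fun n => 1 * _]eq_fun do rewrite mul1r; rewrite /pfun; ring. Qed.

Lemma pfun_zero I l r : pole_span I -> I l -> I r -> l <= r ->
  pfun l * pfun r <= 0 -> exists2 x, I x & pfun x = 0.
Proof.
move=> sI Il Ir lr plr.
have [|x Ix xE] := @span_zero I 1 0 1 (fun=> 1) l r sI (bounded_seq_cst 1) Il Ir lr.
  by rewrite -!pfunE.
by exists x; rewrite // pfunE.
Qed.

Lemma pdiff2_zero I x l r : pole_span I -> off x -> I l -> I r -> l <= r ->
  pdiff2 x l * pdiff2 x r <= 0 -> exists2 y, I y & pdiff2 x y = 0.
Proof.
move=> sI xk Il Ir lr plr.
have E w : pdiff2 x w = 0 * w + 1 + (-1) * wsum a (fun n => rinv x n * rinv w n).
  by rewrite /pdiff2; ring.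
have [|y Iy yE] := @span_zero I 0 1 (-1) _ l r sI (rinv_bounded xk) Il Ir lr.
  by rewrite -!E.
by exists y; rewrite // E.
Qed.

Lemma pdiff3_zero I x y l r : pole_span I -> off x -> off y ->
  I l -> I r -> l <= r ->
  pdiff3 x y l * pdiff3 x y r <= 0 -> exists2 z, I z & pdiff3 x y z = 0.
Proof.
move=> sI xk yk Il Ir lr plr.
have E w : pdiff3 x y w =
    0 * w + 0 + 1 * wsum a (fun n => (rinv x n * rinv y n) * rinv w n).
  by rewrite /pdiff3; ring.
have bxy := bounded_seqM (rinv_bounded xk) (rinv_bounded yk).
have [|z Iz zE] := @span_zero I 0 0 1 _ l r sI bxy Il Ir lr.
  by rewrite -!E.
by exists z; rewrite // E.
Qed.

(* [x], [y] (and [z]) are roots, with repetitions counting multiplicity. *)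
Definition newton2 x y := pfun x = 0 /\ pdiff2 x y = 0.
Definition newton3 x y z := newton2 x y /\ pdiff3 x y z = 0.

Lemma newton2C x y : off x -> off y -> newton2 x y -> newton2 y x.
Proof.
move=> xk yk [px pxy]; split; last by rewrite pdiff2C.
by have := pfun_sub xk yk; rewrite px pxy mulr0 sub0r => /eqP; rewrite oppr_eq0 => /eqP.
Qed.

Lemma newton2_roots x y : off x -> off y -> pfun x = 0 -> pfun y = 0 -> x <> y ->
  newton2 x y.
Proof.
move=> xk yk px py /eqP xy; split=> //; have := pfun_sub xk yk.
by rewrite px py subrr => /esym/eqP; rewrite mulf_eq0 subr_eq0 (negPf xy) => /eqP.
Qed.

Lemma newton3C x y z : off x -> off y -> newton3 x y z -> newton3 y x z.
Proof. by move=> xk yk [nxy xyz]; split; [exact: newton2C|rewrite pdiff3C]. Qed.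

Lemma newton3AC x y z : off x -> off y -> off z -> newton3 x y z -> newton3 x z y.
Proof.
move=> xk yk zk [[px pxy] xyz]; split; last by rewrite pdiff3AC.
split=> //; have := pdiff2_sub xk yk zk.
by rewrite pxy xyz mulr0 sub0r => /eqP; rewrite oppr_eq0 => /eqP.
Qed.

(** Newton's interpolation formula at [x], [y], whose first two coefficients vanish. *)
Lemma newton2_pfun x y w : off x -> off y -> off w -> newton2 x y ->
  pfun w = (w - x) * (w - y) * pdiff3 x y w.
Proof.
move=> xk yk wk [px pxy]; have := pfun_sub wk xk; rewrite px subr0 => ->.
have := pdiff2_sub xk wk yk; rewrite pxy subr0 pdiff2C => ->.
by rewrite mulrA pdiff3AC.
Qed.

Lemma newton2_pdiff2 x y : off x -> off y -> newton2 x y ->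
  pdiff2 x x = (x - y) * pdiff3 x y x.
Proof.
move=> xk yk [px pxy]; have := pdiff2_sub xk xk yk; rewrite pxy subr0 => ->.
by rewrite pdiff3AC.
Qed.

Lemma newton3_pfun x y z w : off x -> off y -> off z -> off w -> newton3 x y z ->
  pfun w = (w - x) * (w - y) * (w - z) * pdiff4 x y w z.
Proof.
move=> xk yk zk wk [nxy xyz]; rewrite (newton2_pfun xk yk wk nxy).
by have := pdiff3_sub xk yk wk zk; rewrite xyz subr0 => ->; rewrite !mulrA.
Qed.

Lemma newton3_pdiff2 x y z : off x -> off y -> off z -> newton3 x y z ->
  pdiff2 x x = (x - y) * (x - z) * pdiff4 x y x z.
Proof.
move=> xk yk zk [nxy xyz]; rewrite (newton2_pdiff2 xk yk nxy).
by have := pdiff3_sub xk yk xk zk; rewrite xyz subr0 => ->; rewrite !mulrA.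
Qed.

(** The last two clauses keep, of the limits [+oo] at the left end and [-oo] at the right end, only
    the signs arbitrarily close to the ends. *)
Definition bounded_type I := [/\ pole_span I, I !=set0,
  (forall c, I c -> exists l, [/\ I l, l < c & 0 < pfun l]) &
  (forall c, I c -> exists r, [/\ I r, c < r & pfun r < 0])].

(* [s] is the common sign of the [x - k n] on [I]. *)
Definition unbounded_type I (s : R) := [/\ pole_span I,
  (forall x n, I x -> 0 < s * (x - k n)),
  (forall c, I c -> exists l, [/\ I l, l < c & 0 < s * pfun l]) &
  (forall c, I c -> exists r, [/\ I r, c < r & 0 < s * pfun r])].

Lemma bounded_root I : bounded_type I -> exists2 x, I x & pfun x = 0.
Proof.
move=> [sI [c Ic] IL IR]; have [l [Il lc pl]] := IL c Ic.
have [r [Ir cr pr]] := IR c Ic.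
apply: (pfun_zero sI Il Ir); first exact: ltW (lt_trans lc cr).
by rewrite pmulr_rle0// ltW.
Qed.

(** At a point outside the span of [x] and [y], [pdiff3 x y] has the sign of [pfun]: positive near
    the left end, negative near the right end. It vanishes in between, at a [z] that may coincide
    with [x] or [y]. *)
Lemma bounded_newton3 I x y : bounded_type I -> I x -> I y -> newton2 x y ->
  exists2 z, I z & newton3 x y z.
Proof.
move=> [sI _ IL IR] Ix Iy nxy.
have xk := span_off sI Ix; have yk := span_off sI Iy.
have Imin : I (Num.min x y) by rewrite minEle; case: ifP.
have Imax : I (Num.max x y) by rewrite maxEle; case: ifP.
have [l [Il + pl]] := IL _ Imin; rewrite lt_min => /andP[lx ly].
have [r [Ir + pr]] := IR _ Imax; rewrite gt_max => /andP[xr yr].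
have [||z Iz xyz] := pdiff3_zero sI xk yk Il Ir.
- exact: ltW (lt_trans lx xr).
- move: pl pr; rewrite !(newton2_pfun xk yk _ nxy); try exact: (span_off sI).
  rewrite pmulr_rgt0 ?nmulr_rgt0 ?subr_lt0// => pl.
  by rewrite pmulr_rlt0 ?mulr_gt0 ?subr_gt0// => pr; rewrite pmulr_rle0// ltW.
by exists z.
Qed.

Lemma bounded_newton3_root I x y z w : bounded_type I -> I x -> I y -> I z ->
  newton3 x y z -> I w -> pfun w = 0 -> [\/ w = x, w = y | w = z].
Proof.
move=> [sI _ _ _] Ix Iy Iz nxyz Iw.
rewrite (newton3_pfun _ _ _ _ nxyz); try exact: (span_off sI).
move=> /eqP; rewrite !mulf_eq0 (lt_eqF (pdiff4_lt0 sI Ix Iy Iw Iz)) orbF.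
rewrite !subr_eq0 => /orP[/orP[]|] /eqP.
- exact: Or31.
- exact: Or32.
- exact: Or33.
Qed.

Lemma bounded_newton3_lt0 I x y z : bounded_type I -> I x -> I y -> I z ->
  newton3 x y z -> (pdiff2 x x < 0) = (0 < (x - y) * (x - z)) /\
                   (0 < pdiff2 x x) = ((x - y) * (x - z) < 0).
Proof.
move=> [sI _ _ _] Ix Iy Iz nxyz.
rewrite (newton3_pdiff2 _ _ _ nxyz); try exact: (span_off sI).
have h := pdiff4_lt0 sI Ix Iy Ix Iz.
split; first by rewrite nmulr_llt0.
by rewrite nmulr_lgt0.
Qed.

Lemma unbounded_pdiff3 I s x y z : unbounded_type I s -> I x -> I y -> I z ->
  0 < s * pdiff3 x y z.
Proof.
move=> [sI sE _ _] Ix Iy Iz.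
have bxyz : bounded_seq (fun n => rinv x n * rinv y n * rinv z n).
  by do 2 (apply: bounded_seqM; last exact: rinv_bounded (span_off sI _));
    exact: rinv_bounded (span_off sI _).
rewrite /pdiff3 -(wsumZ a_gt0 a_sum)//; apply: (wsum_gt0 a_gt0 a_sum).
  by apply: bounded_seqM => //; exact: bounded_seq_cst.
move=> n; have xy : 0 < rinv x n * rinv y n.
  by rewrite /rinv -invfM invr_gt0; exact: sI.1.
rewrite mulrCA mulr_gt0//.
have s0 : s != 0.
  by apply/eqP => s0; have := sE z n Iz; rewrite s0 mul0r ltxx.
have zk : z - k n != 0 by rewrite subr_eq0; apply/eqP; exact: (span_off sI Iz).
(* Only the sign of [s * (z - k n)] is known, so [s / (z - k n)] is rewritten with that product as
   denominator. *)
have -> : s * rinv z n = s ^+ 2 * (s * (z - k n))^-1.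
  by rewrite /rinv; field; rewrite s0 zk.
by apply: mulr_gt0; [rewrite exprn_even_gt0|rewrite invr_gt0 sE].
Qed.

(** [s * pfun] is positive on both sides of the root [x], while [pfun w = (w - x) * pdiff2 x w], so
    [pdiff2 x] changes sign. The point found is a second root, or [x] again if [x] is multiple. *)
Lemma unbounded_newton2 I s x : unbounded_type I s -> I x -> pfun x = 0 ->
  exists2 y, I y & newton2 x y.
Proof.
move=> [sI sE IL IR] Ix px; have xk := span_off sI Ix.
have [l [Il lx pl]] := IL _ Ix; have [r [Ir xr pr]] := IR _ Ix.
have [||y Iy xy] := pdiff2_zero sI xk Il Ir; first exact: ltW (lt_trans lx xr).
  move: pl pr.
  have pE w : I w -> pfun w = (w - x) * pdiff2 x w.
    by move=> /(span_off sI) wk; rewrite pdiff2C -(pfun_sub wk xk) px subr0.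
  rewrite !pE// mulrCA nmulr_rgt0 ?subr_lt0// => sl.
  rewrite mulrCA pmulr_rgt0 ?subr_gt0// => sr.
  have := nmulr_rlt0 (s * pdiff2 x r) sl; rewrite sr.
  have -> : s * pdiff2 x l * (s * pdiff2 x r) = s ^+ 2 * (pdiff2 x l * pdiff2 x r) by ring.
  have [->|s0] := eqVneq s 0; first by rewrite expr0n mul0r ltxx.
  by rewrite pmulr_rlt0 ?exprn_even_gt0// => /ltW.
by exists y.
Qed.

Lemma unbounded_newton2_root I s x y w : unbounded_type I s -> I x -> I y ->
  newton2 x y -> I w -> pfun w = 0 -> w = x \/ w = y.
Proof.
move=> uI Ix Iy nxy Iw; have [sI _ _ _] := uI.
rewrite (newton2_pfun _ _ _ nxy); try exact: (span_off sI).
have := unbounded_pdiff3 uI Ix Iy Iw.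
have [->|q0 _] := eqVneq (pdiff3 x y w) 0; first by rewrite mulr0 ltxx.
move=> /eqP; rewrite !mulf_eq0 (negPf q0) orbF !subr_eq0.
by move=> /orP[] /eqP; [left|right].
Qed.

(** * Root sets of one interval *)

Definition rroots (I : set R) : set R := [set x | I x /\ pfun x = 0].

Lemma newton3_rroots I x y z : bounded_type I -> I x -> I y -> I z ->
  newton3 x y z -> rroots I = [set x; y; z].
Proof.
move=> bI Ix Iy Iz nxyz; have [sI _ _ _] := bI.
have xk := span_off sI Ix; have yk := span_off sI Iy; have zk := span_off sI Iz.
apply/seteqP; split=> w /=.
  move=> [Iw pw]; case: (bounded_newton3_root bI Ix Iy Iz nxyz Iw pw) => ->.
  - by left; left.
  - by left; right.
  - by right.
have nyx := newton3C xk yk nxyz.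
have nzx := newton3C xk zk (newton3AC xk yk zk nxyz).
by move=> [[|]|] ->; split => //; [exact: nxyz.1.1|exact: nyx.1.1|exact: nzx.1.1].
Qed.

Lemma newton2_rroots I s x y : unbounded_type I s -> I x -> I y ->
  newton2 x y -> rroots I = [set x; y].
Proof.
move=> uI Ix Iy nxy; have [sI _ _ _] := uI.
have xk := span_off sI Ix; have yk := span_off sI Iy.
apply/seteqP; split=> w /=.
  by move=> [Iw pw]; exact: (unbounded_newton2_root uI Ix Iy nxy Iw pw).
have nyx := newton2C xk yk nxy.
by move=> [|] ->; split => //; [exact: nxy.1|exact: nyx.1].
Qed.

(** A second root would bring a third, with repetition allowed, and negative derivatives at all
    three make each product of differences positive; yet the product of these is minus a square. *)
Lemma bounded_standard I : bounded_type I ->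
  (forall x, I x -> pfun x = 0 -> pdiff2 x x < 0) ->
  exists2 x, I x & rroots I = [set x].
Proof.
move=> bI sD; have [sI _ _ _] := bI; have [x Ix px] := bounded_root bI.
exists x => //; apply/seteqP; split=> [y /= [Iy py]|y /= ->]; last by [].
apply: contrapT => yx; have xk := span_off sI Ix; have yk := span_off sI Iy.
have [z Iz n3] := bounded_newton3 bI Ix Iy (newton2_roots xk yk px py (nesym yx)).
have zk := span_off sI Iz.
have n3' := newton3C xk yk n3; have n3'' := newton3C xk zk (newton3AC xk yk zk n3).
have := sD _ Ix px; rewrite (bounded_newton3_lt0 bI Ix Iy Iz n3).1.
have := sD _ Iy py; rewrite (bounded_newton3_lt0 bI Iy Ix Iz n3').1.
have := sD _ Iz n3''.1.1; rewrite (bounded_newton3_lt0 bI Iz Ix Iy n3'').1.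
move=> h1 h2 h3; have := mulr_gt0 (mulr_gt0 h1 h2) h3.
apply/negP; rewrite -leNgt.
rewrite [leLHS](_ : _ = - (((x - y) * (x - z) * (y - z)) ^+ 2)); last by ring.
by rewrite oppr_le0 sqr_ge0.
Qed.

Lemma unbounded_sign I s x y : unbounded_type I s -> I x -> I y ->
  newton2 x y -> (0 < s * pdiff2 x x) = (y < x) /\ (s * pdiff2 x x < 0) = (x < y).
Proof.
move=> uI Ix Iy nxy; have [sI _ _ _] := uI.
have q0 := unbounded_pdiff3 uI Ix Iy Ix.
rewrite (newton2_pdiff2 (span_off sI Ix) (span_off sI Iy) nxy) mulrCA.
by rewrite pmulr_lgt0// pmulr_llt0// subr_gt0 subr_lt0.
Qed.

(** A root comes with a partner, and the derivatives at the two have opposite signs, or vanish if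
    they coincide; they cannot both be negative. *)
Lemma unbounded_standard I s : unbounded_type I s ->
  (forall x, I x -> pfun x = 0 -> pdiff2 x x < 0) -> rroots I = set0.
Proof.
move=> uI sD; have [sI _ _ _] := uI.
apply/seteqP; split=> [x /= [Ix px]|//].
have [y Iy nxy] := unbounded_newton2 uI Ix px.
have nyx := newton2C (span_off sI Ix) (span_off sI Iy) nxy.
have [xp xn] := unbounded_sign uI Ix Iy nxy.
have [yp yn] := unbounded_sign uI Iy Ix nyx.
have Dx := sD _ Ix px; have Dy := sD _ Iy nyx.1.
have [s0|s0|s0] := ltgtP s 0.
- move: xp yp; rewrite !nmulr_rgt0// Dx Dy => /esym yx /esym xy.
  by have := lt_trans yx xy; rewrite ltxx.
- move: xn yn; rewrite !pmulr_rlt0// Dx Dy => /esym yx /esym xy.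
  by have := lt_trans yx xy; rewrite ltxx.
- by have := unbounded_pdiff3 uI Ix Ix Ix; rewrite s0 mul0r ltxx.
Qed.

Lemma bounded_three_sorted I x y z : bounded_type I -> I x -> I y -> I z ->
  newton3 x y z -> x <> y -> x <> z -> y <> z ->
  exists u v w, [/\ [/\ I u, I v & I w], u < v < w,
     rroots I = [set u; v; w] &
     [/\ pdiff2 u u < 0, 0 < pdiff2 v v & pdiff2 w w < 0]].
Proof.
move=> bI; have [sI _ _ _] := bI.
(* For ordered roots the derivative signs alternate; the orderings of [x], [y], [z] reduce to this
   by the symmetry of [newton3]. *)
have sorted u v w : I u -> I v -> I w -> newton3 u v w -> u < v -> v < w ->
    exists u v w, [/\ [/\ I u, I v & I w], u < v < w,
     rroots I = [set u; v; w] &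
     [/\ pdiff2 u u < 0, 0 < pdiff2 v v & pdiff2 w w < 0]].
  move=> Iu Iv Iw n3 uv vw; have uw := lt_trans uv vw.
  have uk := span_off sI Iu; have vk := span_off sI Iv; have wk := span_off sI Iw.
  exists u, v, w; split=> //; [by rewrite uv|exact: newton3_rroots|].
  have n3' := newton3C uk vk n3; have n3'' := newton3C uk wk (newton3AC uk vk wk n3).
  rewrite (bounded_newton3_lt0 bI Iu Iv Iw n3).1.
  rewrite (bounded_newton3_lt0 bI Iv Iu Iw n3').2.
  rewrite (bounded_newton3_lt0 bI Iw Iu Iv n3'').1.
  split; first by rewrite nmulr_rgt0 subr_lt0.
    by rewrite pmulr_rlt0 ?subr_gt0// subr_lt0.
  by rewrite mulr_gt0 ?subr_gt0.
move=> Ix Iy Iz n3 xy xz yz.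
have xk := span_off sI Ix; have yk := span_off sI Iy; have zk := span_off sI Iz.
have yxz := newton3C xk yk n3; have xzy := newton3AC xk yk zk n3.
have zxy := newton3C xk zk xzy; have yzx := newton3AC yk xk zk yxz.
have zyx := newton3AC zk xk yk zxy.
have [lxy|lyx|//] := ltgtP x y; have [lyz|lzy|//] := ltgtP y z;
  have [lxz|lzx|//] := ltgtP x z.
- exact: (sorted x y z).
- by have := lt_trans (lt_trans lxy lyz) lzx; rewrite ltxx.
- exact: (sorted x z y).
- exact: (sorted z x y).
- exact: (sorted y x z).
- exact: (sorted y z x).
- by have := lt_trans (lt_trans lzy lyx) lxz; rewrite ltxx.
- exact: (sorted z y x).
Qed.

(** The third root differs from [x] and [y]: coinciding with one of them would make the derivative
    vanish there. *)
Lemma bounded_three I x y : bounded_type I -> I x -> I y -> x <> y ->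
  pfun x = 0 -> pfun y = 0 -> pdiff2 x x <> 0 -> pdiff2 y y <> 0 ->
  exists u v w, [/\ [/\ I u, I v & I w], u < v < w,
     rroots I = [set u; v; w] &
     [/\ pdiff2 u u < 0, 0 < pdiff2 v v & pdiff2 w w < 0]].
Proof.
move=> bI Ix Iy xy px py Dx Dy; have [sI _ _ _] := bI.
have xk := span_off sI Ix; have yk := span_off sI Iy.
have [z Iz n3] := bounded_newton3 bI Ix Iy (newton2_roots xk yk px py xy).
have zk := span_off sI Iz.
apply: (bounded_three_sorted bI Ix Iy Iz n3 xy) => zE.
  by apply: Dx; rewrite (newton3_pdiff2 xk yk zk n3) -zE subrr mulr0 mul0r.
apply: Dy; rewrite (newton3_pdiff2 yk xk zk (newton3C xk yk n3)).
by rewrite -zE subrr mulr0 mul0r.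
Qed.

Lemma unbounded_two I s x y : unbounded_type I s -> I x -> I y -> x <> y ->
  pfun x = 0 -> pfun y = 0 ->
  exists u v, [/\ I u, I v, u <> v, rroots I = [set u; v] &
    pdiff2 u u < 0 /\ 0 < pdiff2 v v].
Proof.
move=> uI Ix Iy xy px py; have [sI _ _ _] := uI.
have xk := span_off sI Ix; have yk := span_off sI Iy.
have nxy := newton2_roots xk yk px py xy; have nyx := newton2C xk yk nxy.
have [xp xn] := unbounded_sign uI Ix Iy nxy.
have [yp yn] := unbounded_sign uI Iy Ix nyx.
have rxy := newton2_rroots uI Ix Iy nxy; have ryx := newton2_rroots uI Iy Ix nyx.
move: xp xn yp yn; have [s0|s0|s0] := ltgtP s 0.
- rewrite !nmulr_rgt0// !nmulr_rlt0// => xp xn yp yn.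
  have [lxy|lyx|//] := ltgtP x y.
    by exists y, x; split=> //; [exact: nesym|rewrite yp xn].
  by exists x, y; split=> //; rewrite xp yn.
- rewrite !pmulr_rgt0// !pmulr_rlt0// => xp xn yp yn.
  have [lxy|lyx|//] := ltgtP x y.
    by exists x, y; split=> //; rewrite xn yp.
  by exists y, x; split=> //; [exact: nesym|rewrite yn xp].
- by have := unbounded_pdiff3 uI Ix Ix Ix; rewrite s0 mul0r ltxx.
Qed.

(** Counting [x] twice, [bounded_newton3] supplies [z], and [pdiff3 x x x] is [x - z] times a
    negative number, so the root is triple exactly when [z] falls on [x]. *)
Lemma bounded_multiple I x : bounded_type I -> I x -> newton2 x x ->
  exists z, [/\ I z, rroots I = [set x; z] & pdiff3 x x x = 0 <-> z = x].
Proof.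
move=> bI Ix nxx; have [sI _ _ _] := bI; have xk := span_off sI Ix.
have [z Iz n3] := bounded_newton3 bI Ix Ix nxx; have zk := span_off sI Iz.
exists z; split=> //.
  rewrite (newton3_rroots bI Ix Ix Iz n3).
  by apply/seteqP; split=> w /= => [[[|]|]|[|]]; tauto.
have := pdiff3_sub xk xk xk zk; rewrite n3.2 subr0 => ->; split => [/eqP|->].
  rewrite mulf_eq0 (lt_eqF (pdiff4_lt0 sI Ix Ix Ix Iz)) orbF subr_eq0.
  by move=> /eqP.
by rewrite subrr mul0r.
Qed.

Lemma unbounded_multiple I s x : unbounded_type I s -> I x -> newton2 x x ->
  rroots I = [set x] /\ pdiff3 x x x <> 0.
Proof.
move=> uI Ix nxx; split; first by rewrite (newton2_rroots uI Ix Ix nxx) setUid.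
by move=> p0; have := unbounded_pdiff3 uI Ix Ix Ix; rewrite p0 mulr0 ltxx.
Qed.

End DividedDifferences.

(** * The intervals between the poles *)

Section Poles.
Set Implicit Arguments.
Unset Strict Implicit.
Variables (R : realType) (a : nat -> R).
Hypotheses (a_gt0 : forall n, 0 < a n) (a_sum : cvgn (series a)).

(** At [k j + t] the pole [k j] contributes [a j / t]. The poles at or left of [k j] contribute
    nonnegative amounts, and those to the right are at distance at least [h / 2], so their total is
    bounded below. *)
Lemma pfun_pos_right_of_pole (k : nat -> R) d j h e :
  0 < d -> (forall m n, m != n -> d <= `|k m - k n|) -> 0 < h ->
  (forall n, k n <= k j \/ k j + h <= k n) -> 0 < e ->
  exists l, k j < l < k j + e /\ 0 < pfun a k l.
Proof.
move=> d0 k_sep h0 kh e0.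
pose B := 2 / h * wsum a (fun=> 1) - k j.
have B1 : 0 < `|B| + 1 by rewrite ltr_wpDl.
(* The last bound makes [a j / t] at least [|B| + 1], which beats the constant [B] collecting all
   negative contributions. *)
pose t := Num.min (Num.min (e / 2) (h / 2)) (a j / (`|B| + 1)).
have t0 : 0 < t by rewrite !lt_min !divr_gt0.
have [te th tB] : [/\ t <= e / 2, t <= h / 2 & t <= a j / (`|B| + 1)].
  by rewrite !ge_min !lexx ?orbT.
have lk n : 0 < k j + t - k n \/ k j + t - k n <= - (h / 2).
  by case: (kh n) => kn; [left|right]; lra.
have loff : off k (k j + t).
  by move=> n E; case: (lk n); rewrite E subrr ?ltxx// lerNr oppr0 leNgt divr_gt0.
exists (k j + t); split.
  by rewrite ltrDl t0/= ltrD2l (le_lt_trans te)// ltr_pdivrMr// ltr_pMr// ltr1n.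
have bl := rinv_bounded d0 k_sep loff.
have bc := bounded_seqD bl (bounded_seq_cst (2 / h * 1)).
(* Adding [2 / h] makes every term nonnegative, so [wsum_ge_term] can isolate the term of index
   [j]. *)
have c0 n : 0 <= rinv k (k j + t) n + 2 / h * 1.
  case: (lk n) => kn.
    by rewrite addr_ge0 ?invr_ge0 ?(ltW kn)// mulr1 divr_ge0// ltW.
  have -> : 2 / h * 1 = - (- (h / 2))^-1 by field; rewrite gt_eqF.
  have h2 : - (h / 2) < 0 by rewrite oppr_lt0 divr_gt0.
  rewrite subr_ge0 lef_nV2//; rewrite ?inE//.
  by rewrite unfold_in /=; exact: le_lt_trans kn h2.
have := wsum_ge_term a_gt0 a_sum j bc c0.
rewrite (wsumD a_gt0 a_sum)//; last exact: bounded_seq_cst.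
rewrite (wsumZ a_gt0 a_sum); last exact: bounded_seq_cst.
have -> : rinv k (k j + t) j = t^-1 by rewrite /rinv addrAC subrr add0r.
have : `|B| + 1 <= a j / t by rewrite ler_pdivlMr// mulrC -ler_pdivlMr.
have : 0 <= a j * (2 / h * 1).
  by rewrite mulr_ge0 ?(ltW (a_gt0 j))// mulr1 divr_ge0// ltW.
rewrite mulrDr /pfun; have := ler_norm B; rewrite /B; lra.
Qed.

Lemma pfun_opp (k : nat -> R) d x :
  0 < d -> (forall m n, m != n -> d <= `|k m - k n|) -> off k x ->
  pfun a (fun n => - k n) (- x) = - pfun a k x.
Proof.
move=> d0 k_sep xk; rewrite /pfun opprD -(wsumN a_gt0 a_sum); last first.
  exact: (rinv_bounded d0 k_sep xk).
congr (_ + wsum _ _); apply/funext => n.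
by rewrite /rinv -opprD invrN.
Qed.

(** Reflection [x -> - x] exchanges this with [pfun_pos_right_of_pole] for the poles [- k n]. *)
Lemma pfun_neg_left_of_pole (k : nat -> R) d j h e :
  0 < d -> (forall m n, m != n -> d <= `|k m - k n|) -> 0 < h ->
  (forall n, k n <= k j - h \/ k j <= k n) -> 0 < e ->
  exists r, k j - e < r < k j /\ pfun a k r < 0.
Proof.
move=> d0 k_sep h0 kh e0.
have k_sep' m n : m != n -> d <= `|- k m - - k n|.
  by move=> /k_sep; rewrite -opprD normrN.
have kh' n : - k n <= - k j \/ - k j + h <= - k n.
  by case: (kh n) => kn; [right|left]; lra.
(* The bound by [h] keeps [- l] inside the gap left of [k j], hence off the poles, as [pfun_opp]
   requires. *)
have e1 : 0 < Num.min e h by rewrite lt_min e0.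
have [l [/andP[jl le]]] := pfun_pos_right_of_pole d0 k_sep' h0 kh' e1.
have [lE lH] : l < - k j + e /\ l < - k j + h.
  by move: le; rewrite -!ltrBlDl lt_min => /andP[].
have off_l : off k (- l).
  by move=> n E; case: (kh n); rewrite -E; lra.
have := pfun_opp d0 k_sep off_l; rewrite opprK => ->; rewrite oppr_gt0 => pl.
by exists (- l); split=> //; apply/andP; split; lra.
Qed.

Variables (k : nat -> R) (d : R).
Hypotheses (d_gt0 : 0 < d) (k_sep : forall m n, m != n -> d <= `|k m - k n|).

Lemma bounded_interval_type I : bounded_interval k I -> bounded_type a k I.
Proof.
move=> [j [j' [[jj' nk] ->]]]; split.
- split.
    move=> x y n /andP[jx xj'] /andP[jy yj'].
    have [nj|jn] := leP (k n) (k j).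
      by rewrite mulr_gt0// subr_gt0 (le_lt_trans nj).
    have j'n : k j' <= k n by rewrite leNgt; apply/negP => nj'; apply: (nk n); rewrite jn.
    by rewrite nmulr_rgt0 ?subr_lt0 (lt_le_trans _ j'n).
  move=> x y z /andP[jx xj'] /andP[jy yj'] /andP[xz zy] /=.
  by rewrite (lt_le_trans jx xz) (le_lt_trans zy).
- by exists ((k j + k j') / 2); apply/andP; split; lra.
- move=> c /andP[jc cj'].
  have h0 : 0 < k j' - k j by rewrite subr_gt0.
  have kh n : k n <= k j \/ k j + (k j' - k j) <= k n.
    have [|jn] := leP (k n) (k j); [by left|right].
    by rewrite addrC subrK leNgt; apply/negP => nj'; apply: (nk n); rewrite jn.
  have c0 : 0 < c - k j by rewrite subr_gt0.
  have [l [/andP[jl lc] pl]] := pfun_pos_right_of_pole d_gt0 k_sep h0 kh c0.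
  by exists l; split=> //; [apply/andP; split|]; lra.
- move=> c /andP[jc cj'].
  have h0 : 0 < k j' - k j by rewrite subr_gt0.
  have kh n : k n <= k j' - (k j' - k j) \/ k j' <= k n.
    have [|jn] := leP (k n) (k j); [by left; lra|right].
    by rewrite leNgt; apply/negP => nj'; apply: (nk n); rewrite jn.
  have c0 : 0 < k j' - c by rewrite subr_gt0.
  have [r [/andP[cr rj'] pr]] := pfun_neg_left_of_pole d_gt0 k_sep h0 kh c0.
  by exists r; split=> //; [apply/andP; split|]; lra.
Qed.

Lemma I_plus_gt x n : I_plus k x -> k n < x.
Proof. by move=> [m km]; exact: le_lt_trans. Qed.

Lemma I_minus_lt x n : I_minus k x -> x < k n.
Proof. by move=> [m km] xm; exact: lt_le_trans (km n). Qed.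

Lemma I_plus_type : I_plus k !=set0 -> unbounded_type a k (I_plus k) 1.
Proof.
move=> [x0 [M kM x0M]]; split.
- split=> [x y n /I_plus_gt xk /I_plus_gt yk|x y z [m km xm] _ /andP[xz _]].
    by rewrite mulr_gt0// subr_gt0.
  by exists m => //; exact: lt_le_trans xz.
- by move=> x n /I_plus_gt xk; rewrite mul1r subr_gt0.
- move=> c /I_plus_gt cM; have c0 : 0 < c - k M by rewrite subr_gt0.
  (* No pole lies right of the maximum, so the gap width 1 is arbitrary. *)
  have kh n : k n <= k M \/ k M + 1 <= k n by left.
  have [l [/andP[Ml lc] pl]] := pfun_pos_right_of_pole d_gt0 k_sep ltr01 kh c0.
  by exists l; split; [exists M|lra|rewrite mul1r].
(* At [Num.max c 0 + 1] both the linear term and the sum are nonnegative, the former strictly. *)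
- move=> c cI; have rI : I_plus k (Num.max c 0 + 1).
    exists M => //; apply: lt_le_trans (I_plus_gt M cI) _.
    by rewrite (le_trans (_ : c <= Num.max c 0)) ?le_max ?lexx// lerDl.
  exists (Num.max c 0 + 1); split=> //.
    by rewrite (le_lt_trans (_ : c <= Num.max c 0)) ?le_max ?lexx// ltrDl.
  rewrite mul1r /pfun ltr_pwDl//; first by rewrite ltr_wpDl// le_max lexx orbT.
  have off_r : off k (Num.max c 0 + 1).
    by move=> n E; have := I_plus_gt n rI; rewrite -E ltxx.
  apply: (wsum_ge0 a_gt0 a_sum) => [|n]; first exact: (rinv_bounded d_gt0 k_sep off_r).
  by rewrite invr_ge0 subr_ge0 ltW// I_plus_gt.
Qed.

Lemma I_minus_type : I_minus k !=set0 -> unbounded_type a k (I_minus k) (-1).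
Proof.
move=> [x0 [M kM x0M]]; split.
- split=> [x y n /I_minus_lt xk /I_minus_lt yk|x y z _ [m km ym] /andP[_ zy]].
    by rewrite nmulr_rgt0 subr_lt0.
  by exists m => //; exact: le_lt_trans ym.
- by move=> x n /I_minus_lt xk; rewrite mulN1r opprB subr_gt0.
- move=> c cI; have rI : I_minus k (Num.min c 0 - 1).
    exists M => //; apply: le_lt_trans (I_minus_lt M cI).
    by rewrite lerBlDr ge_min; apply/orP; left; rewrite lerDl.
  exists (Num.min c 0 - 1); split=> //.
    by rewrite ltrBlDr gt_min ltrDl ltr01.
  rewrite mulN1r oppr_gt0 /pfun.
  have off_r : off k (Num.min c 0 - 1).
    by move=> n E; have := I_minus_lt n rI; rewrite -E ltxx.
  rewrite ltr_nwDl//; first by rewrite subr_lt0 gt_min ltr01 orbT.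
  have bl := rinv_bounded d_gt0 k_sep off_r.
  rewrite -oppr_ge0 -(wsumN a_gt0 a_sum)//.
  apply: (wsum_ge0 a_gt0 a_sum) => [|n]; first exact: bounded_seqN.
  by rewrite oppr_ge0 invr_le0 subr_le0 ltW// I_minus_lt.
- move=> c /I_minus_lt cM; have c0 : 0 < k M - c by rewrite subr_gt0.
  have kh n : k n <= k M - 1 \/ k M <= k n by right.
  have [r [/andP[cr rM] pr]] := pfun_neg_left_of_pole d_gt0 k_sep ltr01 kh c0.
  by exists r; split; [exists M|lra|rewrite mulN1r oppr_gt0].
Qed.

Lemma unbounded_interval_type I : unbounded_interval k I ->
  exists s, unbounded_type a k I s.
Proof.
move=> [I0 [IE|IE]]; rewrite IE in I0 *.
- by exists (-1); exact: I_minus_type.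
- by exists 1; exact: I_plus_type.
Qed.

Lemma PH_interval_span I : PH_interval k I -> pole_span k I.
Proof.
by move=> [/bounded_interval_type[]|/unbounded_interval_type[s []]].
Qed.

Lemma PH_interval_uniq I J x : PH_interval k I -> PH_interval k J -> I x -> J x ->
  I = J.
Proof.
have BU I' J' : bounded_interval k I' -> unbounded_interval k J' -> I' x -> J' x -> False.
  move=> [j [j' [_ ->]]] [_ [|]] -> /andP[jx xj'].
    by move=> /(I_minus_lt j); rewrite ltNge ltW.
  by move=> /(I_plus_gt j'); rewrite ltNge ltW.
move=> [bI|uI] [bJ|uJ] Ix Jx.
- move: bI bJ Ix Jx => [j [j' [[_ jn] ->]]] [i [i' [[_ in_] ->]]] /=.
  move=> /andP[jx xj'] /andP[ix xi'].
  (* If the left ends differed, the larger one would be a pole strictly inside the other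
     interval. *)
  have -> : k j = k i.
    apply/eqP; rewrite eq_le; apply/andP; split; rewrite leNgt; apply/negP => ij.
      by apply: (in_ j); rewrite ij (lt_trans jx).
    by apply: (jn i); rewrite ij (lt_trans ix).
  have -> // : k j' = k i'.
  apply/eqP; rewrite eq_le; apply/andP; split; rewrite leNgt; apply/negP => ij.
    by apply: (jn i'); rewrite ij (lt_trans jx).
  by apply: (in_ j'); rewrite ij (lt_trans ix).
- by case: (BU I J).
- by case: (BU J I).
- move: uI uJ Ix Jx => [_ [|] ->] [_ [|] ->] //.
    by move=> /(I_minus_lt 0) x0 /(I_plus_gt 0); rewrite ltNge ltW.
  by move=> /(I_plus_gt 0) x0 /(I_minus_lt 0); rewrite ltNge ltW.
Qed.

End Poles.

(** * Consequences of the spacing condition *)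

Section Spacing.
Set Implicit Arguments.
Unset Strict Implicit.
Variables (R : realType) (k : nat -> R).
Hypotheses (k_inj : injective k) (k_spacing : spacing_condition k).

Lemma closure_sub_closed (A B : set R) : A `<=` B -> closed B -> closure A `<=` B.
Proof. by move=> /closureS AB /closure_id ->. Qed.

Lemma spacing_cover x : [\/ exists2 m, forall n, k m <= k n & x <= k m,
  exists2 m, forall n, k n <= k m & k m <= x |
  exists j j', consecutive k j j' /\ k j <= x <= k j'].
Proof.
have : [set: R] x by []; rewrite k_spacing.1 => -[[xI|[I [j [j' [jj' ->]]] xI]]|xI].
(* A point in the closure shows that [I_minus] is nonempty, hence that a minimal pole exists. *)
- apply: Or31; have [x0 [m km _]] : I_minus k !=set0.
    by apply: contrapT => /set0P/negP/negPn/eqP I0; rewrite I0 closure0 in xI.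
  exists m => //; apply: (closure_sub_closed _ (@closed_le _ (k m)) xI).
  by move=> y /(I_minus_lt m) /ltW.
- apply: Or33; exists j, j'; split=> //; apply/andP; split.
    apply: (closure_sub_closed _ (@closed_ge _ (k j)) xI).
    by move=> y /= /andP[/ltW].
  apply: (closure_sub_closed _ (@closed_le _ (k j')) xI).
  by move=> y /= /andP[_ /ltW].
- apply: Or32; have [x0 [m km _]] : I_plus k !=set0.
    by apply: contrapT => /set0P/negP/negPn/eqP I0; rewrite I0 closure0 in xI.
  exists m => //; apply: (closure_sub_closed _ (@closed_ge _ (k m)) xI).
  by move=> y /(I_plus_gt m) /ltW.
Qed.

Lemma spacing_interval x : off k x -> exists2 I, PH_interval k I & I x.
Proof.
move=> xk; have lt_k m : x <= k m -> x < k m.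
  by rewrite le_eqVlt => /predU1P[/xk|].
have gt_k m : k m <= x -> k m < x.
  by rewrite le_eqVlt => /predU1P[/esym/xk|].
case: (spacing_cover x) => [[m km xm]|[m km xm]|[j [j' [jj' /andP[jx xj']]]]].
- have xI : I_minus k x by exists m => //; exact: lt_k.
  by exists (I_minus k) => //; right; split; [exists x|left].
- have xI : I_plus k x by exists m => //; exact: gt_k.
  by exists (I_plus k) => //; right; split; [exists x|right].
- exists [set y | k j < y < k j']; first by left; exists j, j'.
  by rewrite /= gt_k// lt_k.
Qed.

(** The midpoint of two poles lies in a closed gap between consecutive poles; that gap fits between
    the two, so their distance is at least its length, hence at least the infimum. *)
Lemma spacing_separated :
  exists2 d, 0 < d & forall m n, m != n -> d <= `|k m - k n|.
Proof.
have [_ d0] := k_spacing.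
exists (inf [set l | exists j j', consecutive k j j' /\ l = k j' - k j]) => //.
have wlog_lt m n : k m < k n ->
    inf [set l | exists j j', consecutive k j j' /\ l = k j' - k j] <= k n - k m.
  move=> mn; case: (spacing_cover ((k m + k n) / 2)).
  - by move=> [p /(_ m) pm]; lra.
  - by move=> [p /(_ n) np]; lra.
  - move=> [j [j' [jj' /andP[jx xj']]]].
    apply: (@le_trans _ _ (k j' - k j)).
      apply: ge_inf; last by exists j, j'.
      (* [ge_inf] needs the set of gap lengths to be bounded below. *)
      by exists 0 => _ [i [i' [[ii' _] ->]]]; rewrite subr_ge0 ltW.
    have mj : k m <= k j.
      by rewrite leNgt; apply/negP => jm; apply: (jj'.2 m); apply/andP; split; lra.
    have nj : k j' <= k n.
      by rewrite leNgt; apply/negP => jn; apply: (jj'.2 n); apply/andP; split; lra.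
    lra.
move=> m n mn; have [kmn|knm|/k_inj/eqP] := ltgtP (k m) (k n).
- by rewrite distrC; apply: le_trans (ler_norm _); exact: wlog_lt.
- by apply: le_trans (ler_norm _); exact: wlog_lt.
- by rewrite (negPf mn).
Qed.

End Spacing.

(** * Real roots of PH *)

Lemma card_set2 (T : Type) (x y : T) : x <> y -> [set x; y] #= `I_2.
Proof.
move=> xy; apply/eq_cardSP; exists x; first by left.
rewrite (_ : _ `\ _ = [set y]); first exact: card_set1.
by apply/seteqP; split=> z /=; [move=> [[|] ->]|move=> ->; split; [right|exact: nesym]].
Qed.

Lemma card_set3 (T : Type) (x y z : T) : x <> y -> x <> z -> y <> z ->
  [set x; y; z] #= `I_3.
Proof.
move=> xy xz yz; apply/eq_cardSP; exists x; first by left; left.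
rewrite (_ : _ `\ _ = [set y; z]); first exact: card_set2.
apply/seteqP; split=> w /=; first by move=> [[[|]|] -> ?] //; [left|right].
by move=> [|] ->; (split; last exact: nesym); [left; right|right].
Qed.

Section RealRoots.
Set Implicit Arguments.
Unset Strict Implicit.
Variables (R : realType) (b k : nat -> R) (d : R).
Hypotheses (b_gt0 : forall n, 0 < b n) (b_sum : cvgn (series b)).
Hypotheses (d_gt0 : 0 < d) (k_sep : forall m n, m != n -> d <= `|k m - k n|).

Local Notation a := (weight b).
Local Notation p := (pfun a k).
Local Notation D x := (pdiff2 a k x x).
Local Notation D3 x := (pdiff3 a k x x x).

Let a_gt0 := weight_gt0 b_gt0.
Let a_sum := weight_sum b_sum.

Lemma off_poles_real x : off_poles k x%:C <-> off k x.
Proof. by split=> xk n; [move=> xn; apply: (xk n); rewrite xn|move/complexI/xk]. Qed.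

Lemma pole_inv_real x n : pole_inv k x%:C n = (rinv k x n)%:C.
Proof. by rewrite /pole_inv -rmorphB -fmorphV. Qed.

Lemma moment_real m x : off k x ->
  moment b k m x%:C = (wsum a (fun n => rinv k x n ^+ m))%:C.
Proof.
move=> xk; rewrite /moment /cwsum.
have E n : pole_inv k x%:C n ^+ m = (rinv k x n ^+ m)%:C.
  by rewrite pole_inv_real -rmorphXn.
under eq_fun do rewrite E.
under [X in Complex _ (wsum _ X)]eq_fun do rewrite E.
rewrite /=; congr Complex.
rewrite -[RHS](mul0r (wsum a (fun=> 0))) -(wsumZ a_gt0 a_sum); last first.
  exact: bounded_seq_cst.
by congr wsum; apply/funext => n; rewrite mul0r.
Qed.

Lemma PH_root_real x : PH_root b k x%:C <-> off k x /\ p x = 0.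
Proof.
rewrite (PH_rootE b_gt0 b_sum d_gt0 k_sep) off_poles_real.
have H : off k x -> x%:C + moment b k 1 x%:C = (p x)%:C.
  by move=> xk; rewrite moment_real// -rmorphD.
split=> -[xk]; rewrite H//; first by move/complexI.
by move=> ->.
Qed.

Lemma dPH1_real x : off k x -> dPH b k 1 x%:C = (D x)%:C.
Proof.
move=> xk; rewrite (dPH1E b_gt0 b_sum d_gt0 k_sep); last exact/off_poles_real.
by rewrite moment_real// rmorphB.
Qed.

Lemma dPH2_real x : off k x -> dPH b k 2 x%:C = (2 * D3 x)%:C.
Proof.
move=> xk; rewrite (dPH2E b_gt0 b_sum d_gt0 k_sep); last exact/off_poles_real.
rewrite moment_real// rmorphM rmorph_nat; congr (_ * (wsum _ _)%:C).
by apply/funext => n; rewrite !exprS expr0 mulr1 mulrA.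
Qed.

Lemma dPH3_real x : off k x -> dPH b k 3 x%:C = (6 * pdiff4 a k x x x x)%:C.
Proof.
move=> xk; rewrite (dPH3E b_gt0 b_sum d_gt0 k_sep); last exact/off_poles_real.
rewrite moment_real// rmorphM rmorph_nat /pdiff4 rmorphN mulrN.
congr (- (_ * (wsum _ _)%:C)).
by apply/funext => n; rewrite !exprS expr0 mulr1 !mulrA.
Qed.

(** The third derivative is negative off the poles, which caps the multiplicity of real roots at
    three. The singleton of [x] serves as a pole span. *)
Lemma dPH3_real_neq0 x : off k x -> dPH b k 3 x%:C <> 0.
Proof.
move=> xk; rewrite dPH3_real// => /complexI/eqP; rewrite mulf_eq0 pnatr_eq0/=.
rewrite lt_eqF//; apply: (@pdiff4_lt0 _ a k d a_gt0 a_sum d_gt0 k_sep [set x]) => //.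
split=> [y z n -> ->|y z w -> -> /andP[xw wx]]; last by apply/eqP; rewrite /= eq_le wx.
by rewrite -expr2 exprn_even_gt0//= subr_eq0; apply/eqP; exact: xk.
Qed.

Lemma gain_real x : off k x -> gain b k x%:C = 1 - D x.
Proof.
move=> xk; rewrite /pdiff2 opprB addrCA subrr addr0; congr wsum.
apply/funext => n; rewrite pole_inv_real sqr_normc_complex.
by rewrite expr0n addr0 expr2.
Qed.

(** On the real line [gain] is 1 minus the derivative, so this is [gain_pair] restated. *)
Lemma real_root_pair x y : off k x -> off k y -> p x = 0 -> p y = 0 -> x <> y ->
  D x + D y < 0.
Proof.
move=> xk yk px py xy.
have := gain_pair b_gt0 b_sum d_gt0 k_sep ((PH_root_real x).2 (conj xk px))
  ((PH_root_real y).2 (conj yk py)).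
rewrite conjc_real !gain_real// => H.
have xyC : x%:C <> y%:C by move/complexI.
by have := H xyC xyC; lra.
Qed.

(** The non-real root has gain 1, so [gain_pair] leaves a gain above 1 for [x]. *)
Lemma nonreal_root_real z x : complex.Im z <> 0 -> PH_root b k z ->
  off k x -> p x = 0 -> D x < 0.
Proof.
move=> Iz rz xk px.
have zx : z <> x%:C by move=> zx; apply: Iz; rewrite zx.
have := gain_pair b_gt0 b_sum d_gt0 k_sep rz ((PH_root_real x).2 (conj xk px)).
rewrite conjc_real gain_real// (gain_nonreal b_gt0 b_sum d_gt0 k_sep)// => H.
by have := H zx zx; lra.
Qed.

Lemma standard_rootE x : standard_root b k x <-> [/\ off k x, p x = 0 & D x < 0].
Proof.
split=> [[/PH_root_real[xk px]]|[xk px Dx]].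
  by rewrite dPH1_real// ltcR.
by split; [exact/PH_root_real|rewrite dPH1_real// ltcR].
Qed.

Lemma simple_rootE x : simple_root b k x%:C <-> [/\ off k x, p x = 0 & D x <> 0].
Proof.
split=> [[xk /(_ 0%N erefl) p0]|[xk px Dx]].
  have /PH_root_real[xo px] : PH_root b k x%:C by split.
  rewrite dPH1_real// => Dx; split=> // D0; apply: Dx; rewrite D0.
  by [].
have [xo P0] := (PH_root_real x).2 (conj xk px).
split=> // [[|]//|]; rewrite dPH1_real//.
by move/complexI.
Qed.

Lemma standard_simple x : standard_root b k x -> simple_root b k x%:C.
Proof.
move=> /standard_rootE[xk px Dx]; apply/simple_rootE; split=> //.
by apply/eqP; rewrite lt_eqF.
Qed.

Lemma multiple_rootE x : multiple_root b k x%:C <-> [/\ off k x, p x = 0 & D x = 0].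
Proof.
split=> [[/PH_root_real[xk px]]|[xk px Dx]].
  by rewrite dPH1_real// => /complexI.
by split; [exact/PH_root_real|rewrite dPH1_real// Dx].
Qed.

Lemma double_rootI x : multiple_root b k x%:C -> D3 x <> 0 -> double_root b k x%:C.
Proof.
move=> [[xo P0] P1] D3x; have xk := (off_poles_real x).1 xo.
split; first exact: xo.
  by case=> [|[|i]] h; [exact: P0|exact: P1|exfalso; move: h].
rewrite (dPH2_real xk) => /complexI/eqP.
by rewrite mulf_eq0 pnatr_eq0/= => /eqP.
Qed.

Lemma triple_rootI x : multiple_root b k x%:C -> D3 x = 0 -> triple_root b k x%:C.
Proof.
move=> [[xo P0] P1] D3x; have xk := (off_poles_real x).1 xo.
split; [exact: xo| |exact: dPH3_real_neq0].
case=> [|[|[|i]]] h; [exact: P0|exact: P1| |by exfalso; move: h].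
by rewrite (dPH2_real xk) D3x mulr0.
Qed.

Lemma roots_inE I : PH_interval k I -> roots_in b k I = rroots a k I.
Proof.
move=> /(PH_interval_span a_gt0 a_sum d_gt0 k_sep) sI.
apply/seteqP; split=> x [Ix] => [/PH_root_real[]//|px]; split=> //.
by apply/PH_root_real; split=> //; exact: (span_off sI).
Qed.

Lemma bounded_standard_root I : bounded_interval k I ->
  (forall x, I x -> p x = 0 -> D x < 0) ->
  exists lambda, roots_in b k I = [set lambda] /\ standard_root b k lambda.
Proof.
move=> bI sD; have tI := bounded_interval_type a_gt0 a_sum d_gt0 k_sep bI.
have [x Ix rI] := bounded_standard a_gt0 a_sum d_gt0 k_sep tI sD.
exists x; rewrite roots_inE; last by left.
split=> //; have [_ px] : rroots a k I x by rewrite rI.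
by apply/standard_rootE; split; [case: tI => sI _ _ _; exact: (span_off sI)| |exact: sD].
Qed.

Lemma unbounded_no_root I : unbounded_interval k I ->
  (forall x, I x -> p x = 0 -> D x < 0) -> roots_in b k I = set0.
Proof.
move=> uI sD; have [s tI] := unbounded_interval_type a_gt0 a_sum d_gt0 k_sep uI.
rewrite roots_inE; last by right.
exact: (unbounded_standard a_gt0 a_sum d_gt0 k_sep tI sD).
Qed.

(** A single real root with nonnegative derivative uses up the only exception: every other root must
    be real and standard. *)
Lemma other_roots_standard v : off k v -> p v = 0 -> 0 <= D v ->
  (forall x, off k x -> p x = 0 -> x <> v -> D x < 0) /\
  (forall z, PH_root b k z -> complex.Im z = 0).
Proof.
move=> vk pv Dv; split=> [x xk px xv|z rz].
  by have := real_root_pair xk vk px pv xv; lra.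
by apply: contrapT => Iz; have := nonreal_root_real Iz rz vk pv; rewrite ltNge Dv.
Qed.

End RealRoots.

(** * Root counts in the three cases *)

Theorem proposition2 (R : realType) (b k : nat -> R)
  (b_gt0 : forall n, 0 < b n) (b_summable : cvgn (series b))
  (k_inj : injective k) (k_spacing : spacing_condition k) :
  (forall beta : R[i], 0 < complex.Im beta -> PH_root b k beta ->
    [/\ forall z : R[i], complex.Im z <> 0 ->
          (PH_root b k z <-> z = beta \/ z = conjc beta),
        simple_root b k beta /\ simple_root b k (conjc beta),
        forall I, bounded_interval k I -> exists lambda : R,
          roots_in b k I = [set lambda] /\ standard_root b k lambda
      & forall I, unbounded_interval k I -> roots_in b k I = set0])
  /\
  (forall I, PH_interval k I ->
    (exists x y : R, [/\ I x, I y, x <> y,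
       simple_root b k x%:C & simple_root b k y%:C]) ->
    [/\ bounded_interval k I ->
          roots_in b k I #= `I_3 /\ standard_roots_in b k I #= `I_2,
        unbounded_interval k I ->
          roots_in b k I #= `I_2 /\ standard_roots_in b k I #= `I_1,
        forall J, bounded_interval k J -> J <> I -> exists lambda : R,
          roots_in b k J = [set lambda] /\ standard_root b k lambda,
        forall J, unbounded_interval k J -> J <> I -> roots_in b k J = set0
      & forall z : R[i], PH_root b k z -> complex.Im z = 0])
  /\
  (forall rho0 : R, multiple_root b k rho0%:C ->
    (exists2 I, PH_interval k I & I rho0) /\
    (forall z : R[i], PH_root b k z -> complex.Im z = 0) /\
    ([/\ double_root b k rho0%:C,
         forall I, bounded_interval k I -> exists lambda : R,
           [/\ roots_in b k I `\ rho0 = [set lambda],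
               simple_root b k lambda%:C & standard_root b k lambda]
       & forall I, unbounded_interval k I -> roots_in b k I `<=` [set rho0]]
     \/
     [/\ triple_root b k rho0%:C,
         exists M, [/\ bounded_interval k M,
           roots_in b k M = [set rho0]
         & forall J, bounded_interval k J -> J <> M -> exists lambda : R,
           [/\ roots_in b k J = [set lambda],
               simple_root b k lambda%:C & standard_root b k lambda]]
       & forall I, unbounded_interval k I -> roots_in b k I = set0])).
Proof.
have [d d0 k_sep] := spacing_separated k_inj k_spacing.
have a_gt0 := weight_gt0 b_gt0; have a_sum := weight_sum b_summable.
have std_bounded := bounded_standard_root b_gt0 b_summable d0 k_sep.
have std_unbounded := unbounded_no_root b_gt0 b_summable d0 k_sep.
have spanI I := @PH_interval_span R _ a_gt0 a_sum k d d0 k_sep I.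
have offI I x : PH_interval k I -> I x -> off k x.
  by move=> /spanI sI; exact: span_off.
have uniqI := @PH_interval_uniq R k.
have rE := roots_inE b_gt0 b_summable d0 k_sep.
have stE := standard_rootE b_gt0 b_summable d0 k_sep.
have siE := simple_rootE b_gt0 b_summable d0 k_sep.
have stsi := standard_simple b_gt0 b_summable d0 k_sep.
have others := other_roots_standard b_gt0 b_summable d0 k_sep.
have typeB := bounded_interval_type a_gt0 a_sum d0 k_sep.
have typeU := unbounded_interval_type a_gt0 a_sum d0 k_sep.
split; last split.
- move=> beta Ibeta rbeta.
  have Ib0 : complex.Im beta <> 0 by apply/eqP; rewrite gt_eqF.
  have rconj := PH_root_conj b_gt0 b_summable d0 k_sep rbeta.
  have Icb0 : complex.Im (conjc beta) <> 0.
    by case: (beta) Ib0 => x y /= y0 /eqP; rewrite oppr_eq0 => /eqP.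
  have std x : off k x -> pfun (weight b) k x = 0 -> pdiff2 (weight b) k x x < 0.
    by move=> xk px; exact: (nonreal_root_real b_gt0 b_summable d0 k_sep Ib0 rbeta).
  have simple_nonreal z : complex.Im z <> 0 -> PH_root b k z -> simple_root b k z.
    move=> Iz rz; split; [exact: rz.1| |].
      by case=> [|i] h; [exact: rz.2|exfalso; move: h].
    exact: (dPH1_nonreal_root b_gt0 b_summable d0 k_sep Iz rz).
  split.
  (* A further non-real root would give [2 < 1 + 1] in [gain_pair]. *)
  + move=> z Iz; split=> [rz|[] ->//]; apply: contrapT => /not_orP[zb zcb].
    have := gain_pair b_gt0 b_summable d0 k_sep rz rbeta zb zcb.
    rewrite !(gain_nonreal b_gt0 b_summable d0 k_sep)//.
    by lra.
  + by split; exact: simple_nonreal.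
  + by move=> I bI; apply: std_bounded => // x Ix; apply: std; apply: offI Ix; left.
  + by move=> I uI; apply: std_unbounded => // x Ix; apply: std; apply: offI Ix; right.
- move=> I HI [x [y [Ix Iy xy /siE[xk px Dx] /siE[yk py Dy]]]].
  (* [v] is the non-standard root of [I]: the middle one of three, or one of the two in an unbounded
     interval. Its positive derivative then constrains all the other roots through [others]. *)
  have [v [Iv pv Dv] cardI] : exists2 v,
      [/\ I v, pfun (weight b) k v = 0 & 0 < pdiff2 (weight b) k v v] &
      (bounded_interval k I ->
        roots_in b k I #= `I_3 /\ standard_roots_in b k I #= `I_2) /\
      (unbounded_interval k I ->
        roots_in b k I #= `I_2 /\ standard_roots_in b k I #= `I_1).
    have notBU : bounded_interval k I -> unbounded_interval k I -> False.
      move=> [j [j' [_ IE]]] [_ [|] IE'].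
        have := Ix; rewrite IE' => /(I_minus_lt j); move: Ix; rewrite IE /=.
        by move=> /andP[jx _]; rewrite ltNge ltW.
      have := Ix; rewrite IE' => /(I_plus_gt j'); move: Ix; rewrite IE /=.
      by move=> /andP[_ xj]; rewrite ltNge ltW.
    case: (HI) => [bI|uI].
      have [u [v [w [[Iu Iv Iw] /andP[uv vw] rI [Du Dv Dw]]]]] :=
        bounded_three a_gt0 a_sum d0 k_sep (typeB _ bI) Ix Iy xy px py Dx Dy.
      have uw := lt_trans uv vw.
      have in_rI z : [set u; v; w] z -> pfun (weight b) k z = 0.
        by rewrite -rI => -[].
      exists v; first by split=> //; apply: in_rI; left; right.
      split=> [_|/(notBU bI)//]; split.
        by rewrite rE// rI; apply: card_set3; apply/eqP; rewrite lt_eqF.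
      rewrite (_ : standard_roots_in b k I = [set u; w]).
        by apply: card_set2; apply/eqP; rewrite lt_eqF.
      apply/seteqP; split=> z /=.
        move=> [Iz /stE[zk pz Dz]].
        have : rroots (weight b) k I z by split.
        rewrite rI => -[[|]|] zE; [by left| |by right].
        by move: Dz; rewrite zE ltNge ltW.
      move=> [|] ->; split=> //; apply/stE; split=> //.
      - exact: offI Iu.
      - by apply: in_rI; left; left.
      - exact: offI Iw.
      - by apply: in_rI; right.
    have [s tI] := typeU _ uI.
    have [u [v [Iu Iv uv rI [Du Dv]]]] :=
      unbounded_two a_gt0 a_sum d0 k_sep tI Ix Iy xy px py.
    have in_rI z : [set u; v] z -> pfun (weight b) k z = 0.
      by rewrite -rI => -[].
    exists v; first by split=> //; apply: in_rI; right.
    split=> [/notBU/(_ uI)//|_]; split.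
      by rewrite rE// rI; apply: card_set2.
    rewrite (_ : standard_roots_in b k I = [set u]); first exact: card_set1.
    apply/seteqP; split=> z /=.
      move=> [Iz /stE[zk pz Dz]].
      have : rroots (weight b) k I z by split.
      rewrite rI => -[//|zE].
      by move: Dz; rewrite zE ltNge ltW.
    move=> ->; split=> //; apply/stE; split=> //; first exact: offI Iu.
    by apply: in_rI; left.
  have [std real_roots] := others v (offI _ _ HI Iv) pv (ltW Dv).
  (* The intervals are disjoint, so a root in [J] cannot be [v] and is standard. *)
  have stdJ J z : PH_interval k J -> J <> I -> J z -> pfun (weight b) k z = 0 ->
      pdiff2 (weight b) k z z < 0.
    move=> HJ JI Jz pz; apply: std => //; first exact: offI Jz.
    by move=> zv; apply: JI; apply: (uniqI _ _ z) => //; rewrite zv.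
  split=> //; [exact: cardI.1|exact: cardI.2| |].
  + by move=> J bJ JI; apply: std_bounded => // z; apply: stdJ => //; left.
  + by move=> J uJ JI; apply: std_unbounded => // z; apply: stdJ => //; right.
- move=> rho mrho; have [rk prho Drho] :=
    (multiple_rootE b_gt0 b_summable d0 k_sep rho).1 mrho.
  have [std real_roots] := others rho rk prho (eq_ind_r (fun t => 0 <= t) (lexx 0) Drho).
  have n2 : newton2 (weight b) k rho rho by split.
  have [M HM Mrho] := spacing_interval k_spacing rk.
  have stdJ J z : PH_interval k J -> ~ J rho -> J z -> pfun (weight b) k z = 0 ->
      pdiff2 (weight b) k z z < 0.
    move=> HJ JI Jz pz; apply: std => //; first exact: offI Jz.
    by move=> zv; apply: JI; rewrite -zv.
  split; first by exists M.
  split; first exact: real_roots.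
  (* [pdiff3] at [rho] is half the second derivative, so it separates triple from double roots. *)
  have [D3|D3] := pselect (pdiff3 (weight b) k rho rho rho = 0); [right|left].
    (* On an unbounded interval [pdiff3] never vanishes, which excludes a triple root there. *)
    have bM : bounded_interval k M.
      case: HM => // /typeU[s tM].
      by case: (unbounded_multiple a_gt0 a_sum d0 k_sep tM Mrho n2).
    split; first exact: (triple_rootI b_gt0 b_summable d0 k_sep).
      exists M; split=> //.
        have [z [_ rM /iffLR/(_ D3) zE]] :=
          bounded_multiple a_gt0 a_sum d0 k_sep (typeB _ bM) Mrho n2.
        by rewrite rE// rM zE setUid.
      move=> J bJ JM; have HJ : PH_interval k J by left.
      have Jrho : ~ J rho by move=> Jrho; apply: JM; exact: (uniqI _ _ rho).
      have [l [rl sl]] := std_bounded _ bJ (fun z => stdJ J z HJ Jrho).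
      by exists l; split=> //; exact: stsi.
    move=> I uI; have HI : PH_interval k I by right.
    apply: std_unbounded => // z; apply: stdJ => // Irho.
    have [s tI] := typeU _ uI.
    by case: (unbounded_multiple a_gt0 a_sum d0 k_sep tI Irho n2).
  split; first exact: (double_rootI b_gt0 b_summable d0 k_sep).
    move=> I bI; have HI : PH_interval k I by left.
    have [Irho|Irho] := pselect (I rho).
      have [z [Iz rI zE]] :=
        bounded_multiple a_gt0 a_sum d0 k_sep (typeB _ bI) Irho n2.
      (* [rho] counts twice among the three roots of the interval; since it is not triple, the
         remaining one is a different root, hence standard. *)
      have zrho : z <> rho by move/zE.
      have sz : standard_root b k z.
        have [_ pz] : rroots (weight b) k I z by rewrite rI; right.
        have zk : off k z := offI _ _ HI Iz.
        by apply/stE; split=> //; exact: std.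
      exists z; split=> //; last exact: stsi.
      rewrite rE// rI; apply/seteqP; split=> w /=.
        by move=> [[|]].
      by move=> ->; split=> //; right.
    have [l [rl sl]] := std_bounded _ bI (fun z => stdJ I z HI Irho).
    exists l; split=> //; last exact: stsi.
    (* Removing [rho] changes nothing in an interval that does not contain it. *)
    rewrite -rl; apply/seteqP; split=> w /=; first by move=> [].
    by move=> [Iw rw]; split=> // wE; apply: Irho; rewrite -wE.
  move=> I uI; have HI : PH_interval k I by right.
  have [Irho|Irho] := pselect (I rho).
    have [s tI] := typeU _ uI.
    have [rI _] := unbounded_multiple a_gt0 a_sum d0 k_sep tI Irho n2.
    by rewrite rE// rI.
  by rewrite (std_unbounded _ uI (fun z => stdJ I z HI Irho)).
Qed.
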